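(* Let $b,c,f\in C^1[0,1]$ satisfy $b(x)\ge\beta>0$ and $c(x)\ge 0$ on $[0,1]$, where $\beta$ is a constant, and fix mesh parameters $q\in(0,1)$ and $a>4/\beta$. Then there exist constants $\varepsilon_0>0$ and $C>0$, both independent of $\varepsilon$ and $N$, such that for every $\varepsilon\in(0,\varepsilon_0]$ (with $a\varepsilon<q$) and every $N$, the solution $U^N$ of the upwind discrete problem on the VB-mesh satisfies $$\left\|U^N-u^N\right\|\le CN^{-1},$$ where $u$ is the solution of the continuous boundary-value problem and $u^N=[u(x_0),u(x_1),\ldots,u(x_N)]^T$.
   Context: Continuous problem: $\mathcal{L}u:=-\varepsilon u''-b(x)u'+c(x)u=f(x)$ for $x\in(0,1)$, $u(0)=u(1)=0$, with a small positive perturbation parameter $\varepsilon$; it has a unique solution $u\in C^3[0,1]$. VB-mesh (Vulanović–Bakhvalov mesh): let $N\ge 2$ be an integer, let $0<q<1$ and $a>0$ be fixed constants with $a\varepsilon<q$, and let $\psi(t)=a\varepsilon\,\frac{t}{q-t}$. Let $\alpha=\frac{q-\sqrt{a\varepsilon q(1-q+a\varepsilon)}}{1+a\varepsilon}$, which lies in $(0,q)$ and satisfies $\psi(\alpha)+\psi'(\alpha)(1-\alpha)=1$. Define $\lambda(t)=\psi(t)$ for $t\in[0,\alpha]$ and $\lambda(t)=\psi(\alpha)+\psi'(\alpha)(t-\alpha)$ for $t\in[\alpha,1]$. The mesh points are $x_i=\lambda(t_i)$, $t_i=i/N$, $i=0,1,\ldots,N$, so $0=x_0<x_1<\dots<x_N=1$.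 Put $h_i=x_i-x_{i-1}$ for $1\le i\le N$ and $\hbar_i=(h_i+h_{i+1})/2$ for $1\le i\le N-1$. Discrete problem: $U^N_0=0$, $U^N_N=0$, and for $i=1,\ldots,N-1$, $$-\varepsilon D''U^N_i-b(x_i)D'U^N_i+c(x_i)U^N_i=f(x_i),$$ where $D''W_i=\frac{1}{\hbar_i}\left(\frac{W_{i+1}-W_i}{h_{i+1}}-\frac{W_i-W_{i-1}}{h_i}\right)$ and $D'W_i=\frac{W_{i+1}-W_i}{h_{i+1}}$. This linear system has a unique solution $U^N=[U^N_0,\ldots,U^N_N]^T$. The norm of a mesh function $W=[W_0,\ldots,W_N]^T$ is $\|W\|=\max_{0\le i\le N}|W_i|$. Constants denoted $C$ are positive and independent of $\varepsilon$ and $N$ (they may depend on $a,q,\beta,b,c,f$). *)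

(* Defs.v *)
From Stdlib Require Import Reals List RList.
From Coquelicot Require Import Coquelicot.

Open Scope R_scope.

Definition I01 (x : R) : Prop := 0 <= x <= 1.

(* The derivatives are taken relative to [0,1], hence one-sided at 0 and 1;
   the values of [g] outside [0,1] are irrelevant. *)
Fixpoint Ck01 (k : nat) (g : R -> R) : Prop :=
  match k with
  | O => continuous_on I01 g
  | S k' => exists g' : R -> R,
      (forall x, I01 x -> D_in g g' I01 x) /\ Ck01 k' g'
  end.

Definition bvp_solution (b c f : R -> R) (eps : R) (u : R -> R) : Prop :=
  Ck01 3 u /\ u 0 = 0 /\ u 1 = 0 /\
  forall x, 0 < x < 1 ->
    - eps * Derive_n u 2 x - b x * Derive u x + c x * u x = f x.

Definition psi (a q eps t : R) : R := a * eps * (t / (q - t)).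

(* The contact point of the tangent line to [psi] through the point (1,1). *)
Definition alpha (a q eps : R) : R :=
  (q - sqrt (a * eps * q * (1 - q + a * eps))) / (1 + a * eps).

Definition lambda (a q eps t : R) : R :=
  let al := alpha a q eps in
  if Rle_dec t al then psi a q eps t
  else psi a q eps al + Derive (psi a q eps) al * (t - al).

Definition mesh (a q eps : R) (N i : nat) : R :=
  lambda a q eps (INR i / INR N).

(* A mesh function [W_0,...,W_N] is a function on [nat] of which only the
   values at 0, ..., N are used.  The operators below are for an arbitrary
   mesh [x]; [step x i] is meaningful for i >= 1 only. *)
Definition step (x : nat -> R) (i : nat) : R := x i - x (i - 1)%nat.

Definition hbar (x : nat -> R) (i : nat) : R :=
  (step x i + step x (i + 1)%nat) / 2.

Definition D1 (x W : nat -> R) (i : nat) : R :=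
  (W (i + 1)%nat - W i) / step x (i + 1)%nat.

Definition D2 (x W : nat -> R) (i : nat) : R :=
  / hbar x i *
  ((W (i + 1)%nat - W i) / step x (i + 1)%nat
   - (W i - W (i - 1)%nat) / step x i).

Definition discrete_solution (b c f : R -> R) (eps : R) (N : nat)
    (x U : nat -> R) : Prop :=
  U 0%nat = 0 /\ U N = 0 /\
  forall i : nat, (1 <= i <= N - 1)%nat ->
    - eps * D2 x U i - b (x i) * D1 x U i + c (x i) * U i = f (x i).

Definition mesh_norm (N : nat) (W : nat -> R) : R :=
  MaxRlist (List.map (fun i => Rabs (W i)) (List.seq 0 (N + 1))).

(* Main.v *)
Require Import Defs.
From Stdlib Require Import Reals List RList Lra Lia Psatz.
From Coquelicot Require Import Coquelicot.

Open Scope R_scope.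

(** The error is controlled by an l1 norm of the truncation error.

    Write [E(x) = exp (- beta x / eps)]. Since the convection coefficient is at
    least [beta], the boundary layer sits at [x = 0], and one obtains
    [|u'| <= K (1 + E / eps)] and [|u''|, eps |u'''| <= K (1 + E / eps^2)]
    ([solution_estimates_uniform]). All of these come from comparison
    arguments: the maximum principle bounds [u]; then [u'] and [u''] each solve
    a first-order equation [eps v' + b v = k] with [k] already bounded, and such
    equations obey a comparison principle ([first_order_comparison]).

    On the discrete side, [|e_i| <= (2 / beta) sum_j hbar_j |tau_j|] for the
    nodal error [e] and the truncation error [tau] ([upwind_stability]). The
    barrier needed for this is explicit: after multiplication by [hbar_i], the
    part [- eps D'' - b D'] of the operator is a first-order recursion for the
    fluxes [- D' W_i], and adding up that recursion bounds the total drop of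
    [W].

    It remains to see that [sum_j hbar_j |tau_j|] is of order [1 / N]. Taylor
    expansion gives
    [hbar_i |tau_i| <= C h_{i+1}^2 (1 + E(x_{i-1}) / eps^2)]
    ([truncation_smooth]), and all steps are at most [C / N]. If [t_{i-1}] is
    beyond the contact point [alpha], then [E(x_{i-1}) <= C eps^2]. If it is
    before [alpha] and at a distance [s >= 3 / N] from the pole [q], then
    [h_{i+1} <= C eps / (N s^2)], while [E(x_{i-1})] is of order
    [exp (- beta a q / s)] and so outweighs [1 / s^4]. In both cases
    [hbar_i |tau_i| <= C / N^2] ([mesh_step_resolves_layer]), and the sum over
    all such nodes is at most [C / N].

    In the remaining case, [t_{i-1} < alpha] and [q - t_{i-1} < 3 / N], the mesh
    may go from resolving the layer to step size [1 / N] within two steps. At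
    most four nodes are concerned ([count_in_window]), so
    [hbar_i |tau_i| <= C / N] suffices for them. This follows without Taylor
    expansion, from [eps u'' + b u' = c u - f] being bounded
    ([truncation_rough]), because at those nodes both [eps] and [E(x_{i-1})]
    are below [C / N] ([layer_small_near_transition]). *)

(** * Calculus and comparison principles *)

Lemma mvt_open (g g' : R -> R) (x y : R) :
  x < y -> continuity g ->
  (forall t, x < t < y -> is_derive g t (g' t)) ->
  exists t, x < t < y /\ g y - g x = g' t * (y - x).
Proof.
  intros Hxy Hc Hd.
  assert (pr1 : forall t, x < t < y -> derivable_pt g t).
  { intros t Ht. exists (g' t). apply is_derive_Reals, Hd, Ht. }
  assert (pr2 : forall t, x < t < y -> derivable_pt id t).
  { intros t Ht. apply derivable_pt_id. }
  destruct (MVT g id x y pr1 pr2 Hxy) as [t [P E]].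
  - intros t _. apply Hc.
  - intros t _. apply derivable_continuous_pt, derivable_pt_id.
  - exists t. split; [exact P|].
    rewrite (derive_pt_eq_0 g t (g' t) (pr1 t P)) in E.
    2: { apply is_derive_Reals, Hd, P. }
    rewrite (derive_pt_eq_0 id t 1 (pr2 t P)) in E.
    2: { apply derivable_pt_lim_id. }
    unfold id in E. lra.
Qed.

Lemma mvt_open_sym (g g' : R -> R) (x y : R) :
  x <> y -> continuity g ->
  (forall t, Rmin x y < t < Rmax x y -> is_derive g t (g' t)) ->
  exists t, Rmin x y < t < Rmax x y /\ g y - g x = g' t * (y - x).
Proof.
  intros Hxy Hc Hd.
  destruct (Rle_or_lt x y) as [H|H].
  - rewrite Rmin_left, Rmax_right in * by lra.
    apply mvt_open; auto; lra.
  - rewrite Rmin_right, Rmax_left in * by lra.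
    destruct (mvt_open g g' y x H Hc Hd) as [t [P E]].
    exists t. split; [exact P | lra].
Qed.

(** Integrates a pointwise bound on [g'] whose integral is known in closed
    form; the constant bound of the mean value theorem would be too weak across
    the layer. *)
Lemma increment_le (g g' phi phi' : R -> R) (x y : R) :
  x <= y -> continuity g -> continuity phi ->
  (forall t, x < t < y -> is_derive g t (g' t)) ->
  (forall t, x < t < y -> is_derive phi t (phi' t)) ->
  (forall t, x < t < y -> Rabs (g' t) <= phi' t) ->
  Rabs (g y - g x) <= phi y - phi x.
Proof.
  intros Hxy Cg Cp Dg Dp Hle.
  destruct (Req_dec x y) as [->|Hne].
  { rewrite !Rminus_diag, Rabs_R0. lra. }
  assert (Hlt : x < y) by lra.
  destruct (mvt_open (fun t => phi t - g t) (fun t => phi' t - g' t) x y Hlt)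
    as [t [Pt Et]].
  { apply continuity_minus; assumption. }
  { intros t Ht. apply @is_derive_minus; auto. }
  destruct (mvt_open (fun t => phi t + g t) (fun t => phi' t + g' t) x y Hlt)
    as [s [Ps Es]].
  { apply continuity_plus; assumption. }
  { intros s Hs. apply @is_derive_plus; auto. }
  pose proof (Hle t Pt) as Ht. pose proof (Hle s Ps) as Hs.
  apply Rabs_le_between in Ht. apply Rabs_le_between in Hs.
  apply Rabs_le. nra.
Qed.

Lemma derive_pos_strict (g : R -> R) (x l : R) :
  is_derive g x l -> 0 < l ->
  exists d, 0 < d /\ forall h, 0 < h < d -> g (x - h) < g x < g (x + h).
Proof.
  intros Hd Hl. apply is_derive_Reals in Hd.
  destruct (Hd l Hl) as [d Hdel].
  exists d. split; [apply cond_pos|].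
  intros h [H0 H1].
  assert (Q : forall k, k <> 0 -> Rabs k < d -> 0 < (g (x + k) - g x) / k).
  { intros k Hk Hkd. specialize (Hdel k Hk Hkd).
    apply Rabs_lt_between in Hdel. lra. }
  assert (Qp := Q h ltac:(lra) ltac:(rewrite Rabs_pos_eq; lra)).
  assert (Qm := Q (- h) ltac:(lra) ltac:(rewrite Rabs_Ropp, Rabs_pos_eq; lra)).
  assert (Ep : g (x + h) - g x = (g (x + h) - g x) / h * h) by (field; lra).
  assert (Em : g (x + - h) - g x = (g (x + - h) - g x) / - h * - h)
    by (field; lra).
  replace (x - h) with (x + - h) by ring.
  split; nra.
Qed.

(** The minimum may sit at the right end [X], where only the left difference
    quotients are available; they give a sign instead of a vanishing
    derivative. *)
Lemma left_minimum_derive (g : R -> R) (x l X : R) :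
  0 < x <= X -> is_derive g x l ->
  (forall y, 0 <= y <= X -> g x <= g y) -> l <= 0.
Proof.
  intros Hx Hd Hmin. destruct (Rle_or_lt l 0) as [|Hl]; [assumption|].
  destruct (derive_pos_strict g x l Hd Hl) as [d [Hd0 H]].
  set (h := Rmin d x / 2).
  assert (Hr0 : 0 < Rmin d x) by (apply Rmin_glb_lt; lra).
  pose proof (Rmin_l d x) as Hr1. pose proof (Rmin_r d x) as Hr2.
  destruct (H h) as [H' _]; [unfold h; lra|].
  specialize (Hmin (x - h)). unfold h in *. lra.
Qed.

Lemma interior_minimum_derive (g : R -> R) (x l : R) :
  0 < x < 1 -> is_derive g x l ->
  (forall y, 0 <= y <= 1 -> g x <= g y) -> l = 0.
Proof.
  intros Hx Hd Hmin.
  assert (l <= 0) by (apply (left_minimum_derive g x l 1); auto; lra).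
  destruct (Rle_or_lt 0 l) as [|Hl]; [lra|].
  destruct (derive_pos_strict (fun t => - g t) x (- l)) as [d [Hd0 H1]].
  { apply @is_derive_opp, Hd. }
  { lra. }
  set (h := Rmin d (1 - x) / 2).
  assert (Hr0 : 0 < Rmin d (1 - x)) by (apply Rmin_glb_lt; lra).
  pose proof (Rmin_l d (1 - x)) as Hr1. pose proof (Rmin_r d (1 - x)) as Hr2.
  destruct (H1 h) as [_ H2]; [unfold h; lra|].
  specialize (Hmin (x + h)). unfold h in *. lra.
Qed.

(** At a negative minimum over [[0, X]] one has [p' <= 0] and [b p < 0], so the
    operator would be negative there. *)
Lemma first_order_nonneg (eps : R) (b p p' : R -> R) :
  0 < eps -> (forall x, 0 < x < 1 -> 0 < b x) -> continuity p ->
  (forall x, 0 < x < 1 -> is_derive p x (p' x)) ->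
  (forall x, 0 < x < 1 -> 0 <= eps * p' x + b x * p x) ->
  0 <= p 0 -> forall x, 0 <= x < 1 -> 0 <= p x.
Proof.
  intros He Hb Cp Dp Hop H0 X HX.
  destruct (Rle_or_lt 0 (p X)) as [|Hneg]; [assumption|exfalso].
  destruct (continuity_ab_min p 0 X) as [m [Hmin Hm]]; [lra|intros; apply Cp|].
  assert (Hpm : p m < 0) by (specialize (Hmin X); lra).
  assert (Hm0 : m <> 0) by (intros ->; lra).
  assert (Hm1 : 0 < m < 1) by lra.
  assert (p' m <= 0).
  { apply (left_minimum_derive p m (p' m) X); auto; lra. }
  specialize (Hop m Hm1). specialize (Hb m Hm1). nra.
Qed.

Lemma first_order_comparison (eps : R) (b v v' z z' : R -> R) :
  0 < eps -> (forall x, 0 < x < 1 -> 0 < b x) ->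
  continuity v -> continuity z ->
  (forall x, 0 < x < 1 -> is_derive v x (v' x)) ->
  (forall x, 0 < x < 1 -> is_derive z x (z' x)) ->
  (forall x, 0 < x < 1 ->
     Rabs (eps * v' x + b x * v x) <= eps * z' x + b x * z x) ->
  Rabs (v 0) <= z 0 ->
  forall x, 0 <= x < 1 -> Rabs (v x) <= z x.
Proof.
  intros He Hb Cv Cz Dv Dz Hop H0 x Hx. apply Rabs_le_between in H0.
  apply Rabs_le. split.
  - enough (0 <= z x + v x) by lra.
    apply (first_order_nonneg eps b (fun t => z t + v t)
      (fun t => z' t + v' t)); auto; try lra.
    + apply continuity_plus; assumption.
    + intros t Ht. apply @is_derive_plus; auto.
    + intros t Ht. specialize (Hop t Ht). apply Rabs_le_between in Hop. lra.
  - enough (0 <= z x - v x) by lra.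
    apply (first_order_nonneg eps b (fun t => z t - v t)
      (fun t => z' t - v' t)); auto; try lra.
    + apply continuity_minus; assumption.
    + intros t Ht. apply @is_derive_minus; auto.
    + intros t Ht. specialize (Hop t Ht). apply Rabs_le_between in Hop. lra.
Qed.

(** At a negative interior minimum, [p' = 0] and [c p <= 0]; the strict
    inequality then forces [p'' < 0], which contradicts minimality. *)
Lemma maximum_principle (eps : R) (b c p p' p'' : R -> R) :
  0 < eps -> (forall x, 0 < x < 1 -> 0 <= c x) -> continuity p ->
  (forall x, 0 < x < 1 -> is_derive p x (p' x)) ->
  (forall x, 0 < x < 1 -> is_derive p' x (p'' x)) ->
  (forall x, 0 < x < 1 -> 0 < - eps * p'' x - b x * p' x + c x * p x) ->
  0 <= p 0 -> 0 <= p 1 -> forall x, 0 <= x <= 1 -> 0 <= p x.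
Proof.
  intros He Hc Cp Dp Dp' Hop H0 H1 x Hx.
  destruct (Rle_or_lt 0 (p x)) as [|Hneg]; [assumption|exfalso].
  destruct (continuity_ab_min p 0 1) as [m [Hmin Hm]]; [lra|intros; apply Cp|].
  assert (Hpm : p m < 0) by (specialize (Hmin x); lra).
  assert (m <> 0) by (intros ->; lra).
  assert (m <> 1) by (intros ->; lra).
  assert (Hm1 : 0 < m < 1) by lra.
  assert (Z : p' m = 0) by (apply (interior_minimum_derive p m); auto).
  specialize (Hop m Hm1). specialize (Hc m Hm1). rewrite Z in Hop.
  assert (Hp2 : p'' m < 0) by nra.
  destruct (derive_pos_strict (fun t => - p' t) m (- p'' m)) as [d [Hd Hstrict]].
  { apply @is_derive_opp, Dp', Hm1. }
  { lra. }
  set (h := Rmin d (1 - m) / 2).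
  assert (Hr0 : 0 < Rmin d (1 - m)) by (apply Rmin_glb_lt; lra).
  pose proof (Rmin_l d (1 - m)) as Hr1. pose proof (Rmin_r d (1 - m)) as Hr2.
  destruct (mvt_open p p' m (m + h)) as [t [Ht Et]]; auto.
  { unfold h; lra. }
  { intros t Ht. apply Dp. unfold h in Ht; lra. }
  destruct (Hstrict (t - m)) as [_ Hs]; [unfold h in Ht; lra|].
  replace (m + (t - m)) with t in Hs by ring. rewrite Z in Hs.
  specialize (Hmin (m + h)). unfold h in *. nra.
Qed.

(** * A priori bounds for the continuous solution *)

Lemma Derive_eq (g : R -> R) (x l : R) :
  is_derive g x l -> Derive (fun t => g t) x = l.
Proof. apply is_derive_unique. Qed.

(** Functions are taken continuous on the whole line, so that extreme value and
    mean value theorems apply on closed subintervals of [[0,1]], while derivatives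
    are only ever used at interior points. *)
Record C1_inside (g g' : R -> R) : Prop := {
  C1_cont : continuity g;
  C1_cont' : continuity g';
  C1_derive : forall x, 0 < x < 1 -> is_derive g x (g' x)
}.

Arguments C1_cont {g g'}.
Arguments C1_cont' {g g'}.
Arguments C1_derive {g g'}.

Record coefficients (b b' c c' f f' : R -> R) (beta B : R) : Prop := {
  coeff_b : C1_inside b b';
  coeff_c : C1_inside c c';
  coeff_f : C1_inside f f';
  coeff_beta : 0 < beta;
  coeff_B : 0 < B;
  coeff_b_range : forall x, 0 <= x <= 1 -> beta <= b x <= B;
  coeff_c_range : forall x, 0 <= x <= 1 -> 0 <= c x <= B;
  coeff_f_bound : forall x, 0 <= x <= 1 -> Rabs (f x) <= B;
  coeff_b'_bound : forall x, 0 <= x <= 1 -> Rabs (b' x) <= B;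
  coeff_c'_bound : forall x, 0 <= x <= 1 -> Rabs (c' x) <= B;
  coeff_f'_bound : forall x, 0 <= x <= 1 -> Rabs (f' x) <= B
}.

Arguments coeff_b {b b' c c' f f' beta B}.
Arguments coeff_c {b b' c c' f f' beta B}.
Arguments coeff_f {b b' c c' f f' beta B}.
Arguments coeff_beta {b b' c c' f f' beta B}.
Arguments coeff_B {b b' c c' f f' beta B}.
Arguments coeff_b_range {b b' c c' f f' beta B}.
Arguments coeff_c_range {b b' c c' f f' beta B}.
Arguments coeff_f_bound {b b' c c' f f' beta B}.
Arguments coeff_b'_bound {b b' c c' f f' beta B}.
Arguments coeff_c'_bound {b b' c c' f f' beta B}.
Arguments coeff_f'_bound {b b' c c' f f' beta B}.

(** The second derivative of the solution, read off from the equation; this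
    form shows that it is continuous up to the end points and differentiable
    inside. *)
Definition curvature (b c f : R -> R) (eps : R) (u u' : R -> R) (x : R) : R :=
  (c x * u x - f x - b x * u' x) / eps.

Record solves (b c f : R -> R) (eps : R) (u u' : R -> R) : Prop := {
  sol_cont : continuity u;
  sol_cont' : continuity u';
  sol_left : u 0 = 0;
  sol_right : u 1 = 0;
  sol_derive : forall x, 0 < x < 1 -> is_derive u x (u' x);
  sol_derive2 : forall x, 0 < x < 1 ->
    is_derive u' x (curvature b c f eps u u' x)
}.

Arguments sol_cont {b c f eps u u'}.
Arguments sol_cont' {b c f eps u u'}.
Arguments sol_left {b c f eps u u'}.
Arguments sol_right {b c f eps u u'}.
Arguments sol_derive {b c f eps u u'}.
Arguments sol_derive2 {b c f eps u u'}.

(** The boundary layer function: it solves [eps v' + beta v = 0]. *)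
Definition layer (beta eps x : R) : R := exp (- (beta * x / eps)).

Lemma layer_pos (beta eps x : R) : 0 < layer beta eps x.
Proof. apply exp_pos. Qed.

Lemma layer_at_0 (beta eps : R) : layer beta eps 0 = 1.
Proof.
  unfold layer. replace (- (beta * 0 / eps)) with 0 by (unfold Rdiv; ring).
  apply exp_0.
Qed.

Lemma exp_mono (x y : R) : x <= y -> exp x <= exp y.
Proof.
  intros [H| ->]; [left; apply exp_increasing, H|apply Rle_refl].
Qed.

Lemma layer_decr (beta eps x y : R) :
  0 < beta -> 0 < eps -> x <= y -> layer beta eps y <= layer beta eps x.
Proof.
  intros Hb He Hxy. unfold layer. apply exp_mono.
  apply Ropp_le_contravar. apply Rmult_le_compat_r.
  - left. apply Rinv_0_lt_compat, He.
  - apply Rmult_le_compat_l; lra.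
Qed.

Lemma layer_derive (beta eps x : R) :
  0 < eps -> is_derive (layer beta eps) x (- (beta / eps) * layer beta eps x).
Proof. intros He. unfold layer. auto_derive; [exact I|unfold Rdiv; ring]. Qed.

Lemma layer_cont (beta eps : R) : 0 < eps -> continuity (layer beta eps).
Proof.
  intros He x. apply derivable_continuous_pt.
  exists (- (beta / eps) * layer beta eps x).
  apply is_derive_Reals, layer_derive, He.
Qed.

(** The differential operator maps the linear barrier [K (1 - x)] to at least
    [K beta], which exceeds [|f|] for [K = (B + 1) / beta]. *)
Lemma solution_bound b b' c c' f f' beta B eps u u' :
  coefficients b b' c c' f f' beta B -> 0 < eps ->
  solves b c f eps u u' ->
  forall x, 0 <= x <= 1 -> Rabs (u x) <= (B + 1) / beta.
Proof.
  intros D He S. pose proof (coeff_beta D) as Hbeta.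
  pose proof (coeff_B D) as HB.
  set (K := (B + 1) / beta).
  assert (HK : K * beta = B + 1) by (unfold K; field; lra).
  assert (HK0 : 0 < K) by (unfold K; apply Rdiv_lt_0_compat; lra).
  assert (Q : forall s, s = 1 \/ s = -1 -> forall x, 0 <= x <= 1 ->
            0 <= K * (1 - x) + s * u x).
  { intros s Hs.
    apply (maximum_principle eps b c (fun x => K * (1 - x) + s * u x)
      (fun x => - K + s * u' x)
      (fun x => s * curvature b c f eps u u' x)); auto.
    - intros x Hx. apply (coeff_c_range D). lra.
    - apply continuity_plus; [reg|].
      apply continuity_mult; [reg|apply (sol_cont S)].
    - intros x Hx. auto_derive.
      + exists (u' x). apply (sol_derive S); auto.
      + rewrite (Derive_eq _ _ _ (sol_derive S x Hx)). ring.
    - intros x Hx. auto_derive.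
      + eexists. apply (sol_derive2 S); auto.
      + rewrite (Derive_eq _ _ _ (sol_derive2 S x Hx)). ring.
    - intros x Hx. assert (Hx' : 0 <= x <= 1) by lra.
      replace (- eps * (s * curvature b c f eps u u' x)
               - b x * (- K + s * u' x) + c x * (K * (1 - x) + s * u x))
        with (s * f x + K * b x + c x * (K * (1 - x)))
        by (unfold curvature; field; lra).
      pose proof (coeff_b_range D x Hx').
      pose proof (coeff_c_range D x Hx').
      pose proof (coeff_f_bound D x Hx') as Hf.
      apply Rabs_le_between in Hf.
      assert (- B <= s * f x) by (destruct Hs as [-> | ->]; lra).
      assert (0 <= c x * (K * (1 - x))).
      { apply Rmult_le_pos; [lra|apply Rmult_le_pos; lra]. }
      nra.
    - rewrite (sol_left S). lra.
    - rewrite (sol_right S). lra. }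
  intros x Hx. pose proof (Q 1 (or_introl eq_refl) x Hx).
  pose proof (Q (-1) (or_intror eq_refl) x Hx).
  apply Rabs_le. nra.
Qed.

Lemma Rabs_mult_le (x y X Y : R) :
  Rabs x <= X -> Rabs y <= Y -> Rabs (x * y) <= X * Y.
Proof.
  intros. rewrite Rabs_mult.
  apply Rmult_le_compat; auto using Rabs_pos.
Qed.

Lemma Rabs_plus_le (x y X Y : R) :
  Rabs x <= X -> Rabs y <= Y -> Rabs (x + y) <= X + Y.
Proof. intros. eapply Rle_trans; [apply Rabs_triang|lra]. Qed.

Lemma Rabs_minus_le (x y X Y : R) :
  Rabs x <= X -> Rabs y <= Y -> Rabs (x - y) <= X + Y.
Proof.
  intros. unfold Rminus. apply Rabs_plus_le; [|rewrite Rabs_Ropp]; assumption.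
Qed.

Lemma reaction_residual_bound b b' c c' f f' beta B (u : R -> R) K :
  coefficients b b' c c' f f' beta B ->
  (forall x, 0 <= x <= 1 -> Rabs (u x) <= K) ->
  forall x, 0 <= x <= 1 -> Rabs (c x * u x - f x) <= B * K + B.
Proof.
  intros D HK x Hx.
  apply Rabs_minus_le; [apply Rabs_mult_le|]; auto.
  - pose proof (coeff_c_range D x Hx).
    rewrite Rabs_pos_eq; lra.
  - apply (coeff_f_bound D x Hx).
Qed.

(** Some point of [(0, eps)] has slope at most [2 K / eps]. From there the bound
    is carried back to 0 by [eps u' + b u], whose derivative [c u - f + b' u] is
    bounded independently of [eps]. *)
Lemma left_slope_bound b b' c c' f f' beta B eps u u' K :
  coefficients b b' c c' f f' beta B -> 0 < eps <= 1 ->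
  solves b c f eps u u' ->
  (forall x, 0 <= x <= 1 -> Rabs (u x) <= K) ->
  eps * Rabs (u' 0) <= 2 * K + 3 * B * K + B.
Proof.
  intros D He S HK.
  pose proof (coeff_B D) as HB.
  destruct (mvt_open u u' 0 eps) as [t [Ht Et]];
    [lra|apply (sol_cont S)| |].
  { intros t Ht. apply (sol_derive S). lra. }
  assert (Hut : Rabs (eps * u' t) <= K + K).
  { replace (eps * u' t) with (u eps - u 0) by lra.
    apply Rabs_minus_le; apply HK; lra. }
  destruct (mvt_open (fun x => eps * u' x + b x * u x)
     (fun x => c x * u x - f x + b' x * u x) 0 t) as [s [Hs Es]]; [lra| | |].
  { apply continuity_plus; apply continuity_mult; try (intros x; reg; fail).
    - apply (sol_cont' S).
    - apply (C1_cont (coeff_b D)).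
    - apply (sol_cont S). }
  { intros x Hx. assert (Hx1 : 0 < x < 1) by lra.
    pose proof (sol_derive S x Hx1) as D1.
    pose proof (sol_derive2 S x Hx1) as D2.
    pose proof (C1_derive (coeff_b D) x Hx1) as D3.
    auto_derive.
    - repeat split; eexists; eassumption.
    - rewrite (Derive_eq _ _ _ D1), (Derive_eq _ _ _ D2),
        (Derive_eq _ _ _ D3).
      unfold curvature. field. lra. }
  assert (Hs1 : 0 <= s <= 1) by lra.
  assert (Hd : Rabs (c s * u s - f s + b' s * u s) <= (B * K + B) + B * K).
  { apply Rabs_plus_le.
    - apply (reaction_residual_bound b b' c c' f f' beta B u K D HK s Hs1).
    - apply Rabs_mult_le; auto. apply (coeff_b'_bound D s Hs1). }
  assert (HK0 : 0 <= K).
  { apply Rle_trans with (Rabs (u s)); auto using Rabs_pos. }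
  assert (Hd' : Rabs ((c s * u s - f s + b' s * u s) * (t - 0))
                <= ((B * K + B) + B * K) * 1).
  { apply Rabs_mult_le; auto. rewrite Rabs_pos_eq; lra. }
  assert (Hb : Rabs (b t * u t) <= B * K).
  { apply Rabs_mult_le; [|apply HK; lra].
    pose proof (coeff_b_range D t ltac:(lra)).
    pose proof (coeff_beta D).
    rewrite Rabs_pos_eq; lra. }
  rewrite (sol_left S) in Es.
  rewrite <- (Rabs_pos_eq eps) by lra. rewrite <- Rabs_mult.
  replace (eps * u' 0) with
    ((eps * u' t + b t * u t) - (c s * u s - f s + b' s * u s) * (t - 0))
    by lra.
  eapply Rle_trans.
  { apply Rabs_minus_le; [apply Rabs_plus_le|]; eassumption. }
  lra.
Qed.

(** The slope solves [eps v' + b v = c u - f], for which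
    [(A / eps) E + G / beta] is a supersolution, [E] being the layer function. *)
Lemma slope_bound b b' c c' f f' beta B eps u u' A G :
  coefficients b b' c c' f f' beta B -> 0 < eps ->
  solves b c f eps u u' ->
  (forall x, 0 <= x <= 1 -> Rabs (c x * u x - f x) <= G) ->
  eps * Rabs (u' 0) <= A ->
  forall x, 0 <= x < 1 ->
    Rabs (u' x) <= (A + G / beta) * (1 + layer beta eps x / eps).
Proof.
  intros D He S HG HA x Hx.
  pose proof (coeff_beta D) as Hbeta.
  assert (HA0 : 0 <= A).
  { eapply Rle_trans; [|exact HA]. apply Rmult_le_pos; [lra|apply Rabs_pos]. }
  assert (HG0 : 0 <= G / beta).
  { apply Rmult_le_pos; [|left; apply Rinv_0_lt_compat; lra].
    eapply Rle_trans; [|apply (HG 0); lra]. apply Rabs_pos. }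
  assert (HGb : G / beta * beta = G) by (field; lra).
  apply Rle_trans with (A / eps * layer beta eps x + G / beta).
  - apply (first_order_comparison eps b u' (curvature b c f eps u u')
      (fun x => A / eps * layer beta eps x + G / beta)
      (fun x => A / eps * (- (beta / eps) * layer beta eps x))); auto.
    + intros t Ht. pose proof (coeff_b_range D t ltac:(lra)).
      lra.
    + apply (sol_cont' S).
    + apply continuity_plus; [apply continuity_mult|];
        [reg|apply layer_cont; lra|reg].
    + apply (sol_derive2 S).
    + intros t Ht. pose proof (layer_derive beta eps t He) as DL.
      auto_derive; [eexists; eassumption|].
      rewrite (Derive_eq _ _ _ DL). ring.
    + intros t Ht. assert (Ht' : 0 <= t <= 1) by lra.
      replace (eps * curvature b c f eps u u' t + b t * u' t)
        with (c t * u t - f t) by (unfold curvature; field; lra).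
      pose proof (coeff_b_range D t Ht').
      replace (eps * (A / eps * (- (beta / eps) * layer beta eps t))
               + b t * (A / eps * layer beta eps t + G / beta))
        with ((b t - beta) * (A / eps * layer beta eps t)
              + (b t - beta) * (G / beta) + G) by (field; lra).
      pose proof (layer_pos beta eps t).
      assert (0 <= A / eps * layer beta eps t).
      { apply Rmult_le_pos; [|lra].
        apply Rmult_le_pos; [lra|left; apply Rinv_0_lt_compat; lra]. }
      assert (0 <= (b t - beta) * (A / eps * layer beta eps t))
        by (apply Rmult_le_pos; lra).
      assert (0 <= (b t - beta) * (G / beta)) by (apply Rmult_le_pos; lra).
      specialize (HG t Ht'). lra.
    + rewrite layer_at_0.
      apply Rmult_le_reg_l with eps; [lra|].
      replace (eps * (A / eps * 1 + G / beta)) with (A + eps * (G / beta))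
        by (field; lra).
      assert (0 <= eps * (G / beta)) by (apply Rmult_le_pos; lra). lra.
  - assert (0 <= layer beta eps x / eps).
    { apply Rmult_le_pos; [left; apply layer_pos|].
      left; apply Rinv_0_lt_compat; lra. }
    replace (A / eps * layer beta eps x) with (A * (layer beta eps x / eps))
      by (field; lra).
    assert (0 <= G / beta * (layer beta eps x / eps))
      by (apply Rmult_le_pos; lra).
    lra.
Qed.

(** The derivative of the curvature [p], from the differentiated equation
    [eps p' + b p = c' u + (c - b') u' - f']. *)
Definition curvature' (b b' c c' f' : R -> R) (eps : R) (u u' p : R -> R)
    (x : R) : R :=
  (c' x * u x + (c x - b' x) * u' x - f' x - b x * p x) / eps.

Lemma curvature_derive b b' c c' f f' beta B eps u u' :
  coefficients b b' c c' f f' beta B -> 0 < eps ->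
  solves b c f eps u u' ->
  forall x, 0 < x < 1 ->
    is_derive (curvature b c f eps u u') x
      (curvature' b b' c c' f' eps u u' (curvature b c f eps u u') x).
Proof.
  intros D He S x Hx.
  pose proof (sol_derive S x Hx) as D1.
  pose proof (sol_derive2 S x Hx) as D2.
  pose proof (C1_derive (coeff_b D) x Hx) as D3.
  pose proof (C1_derive (coeff_c D) x Hx) as D4.
  pose proof (C1_derive (coeff_f D) x Hx) as D5.
  set (p := curvature b c f eps u u') in *.
  unfold p at 1, curvature at 1.
  auto_derive.
  - repeat split; eexists; eassumption.
  - rewrite (Derive_eq _ _ _ D1), (Derive_eq _ _ _ D2),
      (Derive_eq _ _ _ D3), (Derive_eq _ _ _ D4),
      (Derive_eq _ _ _ D5).
    unfold curvature'. field. lra.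
Qed.

Lemma curvature_cont b b' c c' f f' beta B eps u u' :
  coefficients b b' c c' f f' beta B ->
  solves b c f eps u u' -> continuity (curvature b c f eps u u').
Proof.
  intros D S.
  pose proof (C1_cont (coeff_b D)).
  pose proof (C1_cont (coeff_c D)).
  pose proof (C1_cont (coeff_f D)).
  pose proof (sol_cont S).
  pose proof (sol_cont' S).
  unfold curvature, Rdiv.
  apply continuity_mult; [|intros x; reg].
  apply continuity_minus; [apply continuity_minus; [|assumption]|];
    apply continuity_mult; assumption.
Qed.

Lemma differentiated_residual_bound b b' c c' f f' beta B eps
    (u u' : R -> R) K K1 :
  coefficients b b' c c' f f' beta B -> 0 < eps ->
  (forall x, 0 <= x <= 1 -> Rabs (u x) <= K) ->
  (forall x, 0 <= x < 1 -> Rabs (u' x) <= K1 * (1 + layer beta eps x / eps)) ->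
  forall x, 0 <= x < 1 ->
    Rabs (c' x * u x + (c x - b' x) * u' x - f' x)
    <= (B * K + 2 * B * K1 + B) * (1 + layer beta eps x / eps).
Proof.
  intros D He HK HK1 x Hx. assert (Hx' : 0 <= x <= 1) by lra.
  pose proof (coeff_B D) as HB.
  assert (L : 0 <= layer beta eps x / eps).
  { apply Rmult_le_pos; [left; apply layer_pos|].
    left; apply Rinv_0_lt_compat; lra. }
  assert (HK0 : 0 <= K).
  { apply Rle_trans with (Rabs (u x)); auto using Rabs_pos. }
  eapply Rle_trans.
  - apply Rabs_minus_le; [apply Rabs_plus_le; apply Rabs_mult_le|].
    + apply (coeff_c'_bound D x Hx').
    + apply HK, Hx'.
    + apply Rabs_minus_le.
      * pose proof (coeff_c_range D x Hx') as Hc.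
        rewrite Rabs_pos_eq; apply Hc.
      * apply (coeff_b'_bound D x Hx').
    + apply HK1, Hx.
    + apply (coeff_f'_bound D x Hx').
  - set (l := layer beta eps x / eps) in *.
    assert (0 <= B * K) by (apply Rmult_le_pos; lra).
    assert (0 <= (B * K + B) * l) by (apply Rmult_le_pos; lra).
    nra.
Qed.

(** The right-hand side of the equation for the curvature contains a multiple of
    [E / eps], which resonates with the homogeneous solution [E]. Hence the factor
    [x] in the supersolution, which is harmless on [[0,1]]. *)
Lemma curvature_bound b b' c c' f f' beta B eps u u' A M :
  coefficients b b' c c' f f' beta B -> 0 < eps <= 1 ->
  solves b c f eps u u' ->
  (forall x, 0 <= x < 1 ->
    Rabs (c' x * u x + (c x - b' x) * u' x - f' x)
    <= M * (1 + layer beta eps x / eps)) ->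
  Rabs (curvature b c f eps u u' 0) <= A / eps ^ 2 ->
  forall x, 0 <= x < 1 ->
    Rabs (curvature b c f eps u u' x)
    <= (A + M + M / beta) * (1 + layer beta eps x / eps ^ 2).
Proof.
  intros D He S HM HA x Hx.
  pose proof (coeff_beta D) as Hbeta.
  set (p := curvature b c f eps u u') in *.
  assert (Hi : 0 < / eps) by (apply Rinv_0_lt_compat; lra).
  assert (Hi2 : 0 < / eps ^ 2) by (apply Rinv_0_lt_compat, pow_lt; lra).
  assert (HA0 : 0 <= A).
  { apply Rmult_le_reg_r with (/ eps ^ 2); [assumption|].
    rewrite Rmult_0_l. eapply Rle_trans; [apply Rabs_pos|exact HA]. }
  assert (HM0 : 0 <= M).
  { pose proof (HM 0 ltac:(lra)) as H0. rewrite layer_at_0 in H0.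
    apply Rmult_le_reg_r with (1 + 1 / eps).
    - unfold Rdiv. lra.
    - rewrite Rmult_0_l. eapply Rle_trans; [apply Rabs_pos|exact H0]. }
  assert (HMb : 0 <= M / beta).
  { apply Rmult_le_pos; [lra|left; apply Rinv_0_lt_compat; lra]. }
  assert (EMb : M / beta * beta = M) by (field; lra).
  apply Rle_trans with
    (A / eps ^ 2 * layer beta eps x + M / beta
     + M / eps ^ 2 * (x * layer beta eps x)).
  - apply (first_order_comparison eps b p
      (curvature' b b' c c' f' eps u u' p)
      (fun x => A / eps ^ 2 * layer beta eps x + M / beta
                + M / eps ^ 2 * (x * layer beta eps x))
      (fun x => A / eps ^ 2 * (- (beta / eps) * layer beta eps x)
                + M / eps ^ 2 * (layer beta eps x
                  + x * (- (beta / eps) * layer beta eps x)))); auto.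
    + lra.
    + intros t Ht. pose proof (coeff_b_range D t ltac:(lra)).
      lra.
    + apply (curvature_cont b b' c c' f f' beta B eps u u' D S).
    + assert (continuity (layer beta eps)) by (apply layer_cont; lra).
      apply continuity_plus; [apply continuity_plus|];
        repeat apply continuity_mult; auto; intros y; reg.
    + apply (curvature_derive b b' c c' f f' beta B eps u u' D); auto; lra.
    + intros t Ht. pose proof (layer_derive beta eps t ltac:(lra)) as DL.
      auto_derive; [repeat split; eexists; eassumption|].
      rewrite (Derive_eq _ _ _ DL). field; lra.
    + intros t Ht. assert (Ht' : 0 <= t <= 1) by lra.
      replace (eps * curvature' b b' c c' f' eps u u' p t + b t * p t)
        with (c' t * u t + (c t - b' t) * u' t - f' t)
        by (unfold curvature'; field; lra).
      pose proof (coeff_b_range D t Ht').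
      pose proof (layer_pos beta eps t) as HL.
      match goal with |- _ <= ?r =>
        replace r with ((b t - beta) * (A / eps ^ 2 * layer beta eps t)
          + (b t - beta) * (M / beta)
          + (b t - beta) * (M / eps ^ 2 * (t * layer beta eps t))
          + M * (1 + layer beta eps t / eps)) by (field; lra) end.
      assert (0 <= (b t - beta) * (A / eps ^ 2 * layer beta eps t)).
      { repeat apply Rmult_le_pos; lra. }
      assert (0 <= (b t - beta) * (M / beta)) by (apply Rmult_le_pos; lra).
      assert (0 <= (b t - beta) * (M / eps ^ 2 * (t * layer beta eps t))).
      { repeat apply Rmult_le_pos; lra. }
      pose proof (HM t ltac:(lra)). lra.
    + rewrite layer_at_0. lra.
  - pose proof (layer_pos beta eps x) as HL.
    assert (Hl : 0 <= layer beta eps x / eps ^ 2)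
      by (apply Rmult_le_pos; lra).
    replace (A / eps ^ 2 * layer beta eps x) with
      (A * (layer beta eps x / eps ^ 2)) by (field; lra).
    replace (M / eps ^ 2 * (x * layer beta eps x)) with
      (x * (M * (layer beta eps x / eps ^ 2))) by (field; lra).
    set (l := layer beta eps x / eps ^ 2) in *.
    assert (0 <= M * l) by (apply Rmult_le_pos; lra).
    assert (0 <= M / beta * l) by (apply Rmult_le_pos; lra).
    assert (x * (M * l) <= 1 * (M * l)) by (apply Rmult_le_compat_r; lra).
    lra.
Qed.

Record solution_estimates (b c f : R -> R) (beta eps K : R)
    (u u' : R -> R) : Prop := {
  est_residual : forall x, 0 <= x <= 1 -> Rabs (c x * u x - f x) <= K;
  est_slope : forall x, 0 < x < 1 ->
    Rabs (u' x) <= K * (1 + layer beta eps x / eps);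
  est_curvature : forall x, 0 < x < 1 ->
    Rabs (curvature b c f eps u u' x) <= K * (1 + layer beta eps x / eps ^ 2);
  est_curvature' : forall x, 0 < x < 1 -> exists d,
    is_derive (curvature b c f eps u u') x d /\
    eps * Rabs d <= K * (1 + layer beta eps x / eps ^ 2)
}.

Arguments est_residual {b c f beta eps K u u'}.
Arguments est_slope {b c f beta eps K u u'}.
Arguments est_curvature {b c f beta eps K u u'}.
Arguments est_curvature' {b c f beta eps K u u'}.

Lemma solution_estimates_uniform b b' c c' f f' beta B :
  coefficients b b' c c' f f' beta B ->
  exists K, 0 < K /\ forall eps u u', 0 < eps <= 1 -> solves b c f eps u u' ->
    solution_estimates b c f beta eps K u u'.
Proof.
  intros D.
  pose proof (coeff_beta D) as Hbeta.
  pose proof (coeff_B D) as HB.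
  set (K0 := (B + 1) / beta).
  set (G := B * K0 + B).
  set (A1 := 2 * K0 + 3 * B * K0 + B).
  set (K1 := A1 + G / beta).
  set (M := B * K0 + 2 * B * K1 + B).
  set (A2 := G + B * A1).
  set (K2 := A2 + M + M / beta).
  set (K3 := B * K2 + M).
  assert (P0 : 0 < K0) by (apply Rdiv_lt_0_compat; lra).
  assert (PBK : 0 < B * K0) by (apply Rmult_lt_0_compat; lra).
  assert (PG : 0 < G) by (unfold G; lra).
  assert (PA1 : 0 < A1) by (unfold A1; lra).
  assert (PK1 : 0 < K1).
  { unfold K1. assert (0 < G / beta) by (apply Rdiv_lt_0_compat; lra). lra. }
  assert (PM : 0 < M).
  { unfold M. assert (0 < B * K1) by (apply Rmult_lt_0_compat; lra). lra. }
  assert (PA2 : 0 < A2).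
  { unfold A2. assert (0 < B * A1) by (apply Rmult_lt_0_compat; lra). lra. }
  assert (PK2 : 0 < K2).
  { unfold K2. assert (0 < M / beta) by (apply Rdiv_lt_0_compat; lra). lra. }
  assert (PK3 : 0 < K3).
  { unfold K3. assert (0 < B * K2) by (apply Rmult_lt_0_compat; lra). lra. }
  exists (G + K1 + K2 + K3). split; [lra|].
  intros eps u u' He S.
  assert (Hi : 1 <= / eps).
  { rewrite <- Rinv_1. apply Rinv_le_contravar; lra. }
  assert (Hi2 : / eps ^ 2 = / eps * / eps) by (field; lra).
  assert (E0 := solution_bound b b' c c' f f' beta B eps u u' D ltac:(lra) S).
  fold K0 in E0.
  assert (EG := reaction_residual_bound b b' c c' f f' beta B u K0 D E0).
  fold G in EG.
  assert (EA := left_slope_bound b b' c c' f f' beta B eps u u' K0 D He S E0).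
  fold A1 in EA.
  assert (E1 := slope_bound b b' c c' f f' beta B eps u u' A1 G D ltac:(lra) S
    EG EA).
  fold K1 in E1.
  assert (EM := differentiated_residual_bound b b' c c' f f' beta B eps u u'
    K0 K1 D ltac:(lra) E0 E1).
  fold M in EM.
  assert (EA2 : Rabs (curvature b c f eps u u' 0) <= A2 / eps ^ 2).
  { unfold curvature.
    replace ((c 0 * u 0 - f 0 - b 0 * u' 0) / eps) with
      ((eps * (c 0 * u 0 - f 0) - b 0 * (eps * u' 0)) * / eps ^ 2)
      by (field; lra).
    unfold Rdiv. rewrite Rabs_mult.
    rewrite (Rabs_pos_eq (/ eps ^ 2)) by (rewrite Hi2; nra).
    apply Rmult_le_compat_r; [rewrite Hi2; nra|].
    unfold A2. apply Rabs_minus_le.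
    - replace G with (1 * G) by ring. apply Rabs_mult_le.
      + rewrite Rabs_pos_eq; lra.
      + apply EG; lra.
    - apply Rabs_mult_le.
      + pose proof (coeff_b_range D 0 ltac:(lra)).
        rewrite Rabs_pos_eq; lra.
      + rewrite Rabs_mult, (Rabs_pos_eq eps) by lra. exact EA. }
  assert (E2 := curvature_bound b b' c c' f f' beta B eps u u' A2 M D He S
    EM EA2).
  fold K2 in E2.
  assert (W : forall k X x, 0 < k <= G + K1 + K2 + K3 -> 0 <= X ->
    x <= k * (1 + X) -> x <= (G + K1 + K2 + K3) * (1 + X)).
  { intros k X x Hk HX Hx. eapply Rle_trans; [exact Hx|].
    apply Rmult_le_compat_r; lra. }
  assert (L1 : forall x, 0 <= layer beta eps x / eps).
  { intros x. apply Rmult_le_pos; [left; apply layer_pos|lra]. }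
  assert (L2 : forall x, layer beta eps x / eps <= layer beta eps x / eps ^ 2).
  { intros x. unfold Rdiv. apply Rmult_le_compat_l; [left; apply layer_pos|].
    rewrite Hi2. nra. }
  constructor.
  - intros x Hx. specialize (EG x Hx). lra.
  - intros x Hx. apply (W K1); auto; [lra|]. apply E1; lra.
  - intros x Hx. specialize (L1 x); specialize (L2 x).
    apply (W K2); [lra|lra|]. apply E2; lra.
  - intros x Hx. specialize (L1 x); specialize (L2 x).
    eexists. split.
    + apply (curvature_derive b b' c c' f f' beta B eps u u' D ltac:(lra) S x Hx).
    + rewrite <- (Rabs_pos_eq eps) at 1 by lra. rewrite <- Rabs_mult.
      set (p := curvature b c f eps u u') in *.
      replace (eps * curvature' b b' c c' f' eps u u' p x) with
        ((c' x * u x + (c x - b' x) * u' x - f' x) - b x * p x)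
        by (unfold curvature'; field; lra).
      apply (W K3); [lra|lra|].
      eapply Rle_trans.
      * apply Rabs_minus_le; [apply EM; lra|].
        apply Rabs_mult_le; [|apply E2; lra].
        pose proof (coeff_b_range D x ltac:(lra)) as Hb.
        rewrite Rabs_pos_eq; [apply Hb|lra].
      * unfold K3.
        assert (M * (1 + layer beta eps x / eps)
                <= M * (1 + layer beta eps x / eps ^ 2)).
        { apply Rmult_le_compat_l; lra. }
        lra.
Qed.

(** * The truncation error at one mesh point *)

(** The constant is not sharp: two nested mean values give the factor 1.
    Points on either side of [x] are allowed, for the forward and the backward
    difference quotients. *)
Lemma second_order_taylor (u u' p p' : R -> R) (x y M : R) :
  continuity u -> continuity u' -> continuity p ->
  0 < x < 1 -> 0 <= y <= 1 ->
  (forall t, 0 < t < 1 -> is_derive u t (u' t)) ->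
  (forall t, 0 < t < 1 -> is_derive u' t (p t)) ->
  (forall t, 0 < t < 1 -> is_derive p t (p' t)) ->
  (forall t, Rmin x y < t < Rmax x y -> Rabs (p' t) <= M) ->
  Rabs (u y - u x - u' x * (y - x) - p x * (y - x) ^ 2 / 2)
  <= M * Rabs (y - x) ^ 3.
Proof.
  intros Cu Cu' Cp Hx Hy Du Du' Dp HM.
  destruct (Req_dec x y) as [<-|Hne].
  { rewrite !Rminus_diag. rewrite Rabs_R0.
    replace (0 - u' x * 0 - p x * 0 ^ 2 / 2) with 0 by field.
    rewrite Rabs_R0. lra. }
  assert (R0 : 0 <= Rmin x y) by (apply Rmin_glb; lra).
  assert (R1 : Rmax x y <= 1) by (apply Rmax_lub; lra).
  assert (Sub : forall t, Rmin x y < t < Rmax x y ->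
    0 < t < 1 /\ t <> x /\ Rmin x y <= Rmin x t /\ Rmax x t <= Rmax x y
    /\ Rabs (t - x) <= Rabs (y - x)).
  { intros t. unfold Rmin, Rmax, Rabs.
    destruct (Rle_dec x y), (Rle_dec x t), (Rcase_abs (t - x)),
      (Rcase_abs (y - x)); unfold Rmin, Rmax in R0, R1;
      destruct (Rle_dec x y); lra. }
  destruct (mvt_open_sym
    (fun t => u t - u' x * (t - x) - p x * (t - x) ^ 2 / 2)
    (fun t => u' t - u' x - p x * (t - x)) x y Hne) as [s [Hs Es]].
  { apply continuity_minus; [apply continuity_minus; [exact Cu|]|];
      intros t; reg. }
  { intros t Ht. destruct (Sub t Ht) as [Ht1 _]. pose proof (Du t Ht1) as D.
    auto_derive; [repeat split; eexists; eassumption|].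
    rewrite (Derive_eq _ _ _ D). field. }
  destruct (Sub s Hs) as [Hs1 [Hsne [Hs2 [Hs3 Hs4]]]].
  destruct (mvt_open_sym u' p x s) as [r [Hr Er]]; auto.
  { intros t Ht. apply Du'. destruct (Sub t); [lra|assumption]. }
  destruct (Sub r) as [Hr1 [Hrne [Hr2 [Hr3 Hr4]]]]; [lra|].
  destruct (mvt_open_sym p p' x r) as [w [Hw Ew]]; auto.
  { intros t Ht. apply Dp. destruct (Sub t); [lra|assumption]. }
  specialize (HM w ltac:(lra)).
  replace (u y - u x - u' x * (y - x) - p x * (y - x) ^ 2 / 2)
    with (p' w * (r - x) * (s - x) * (y - x)).
  2: { rewrite <- Ew. replace (u' x) with (u' s - p r * (s - x)) by lra.
       assert (u y = u x + u' x * (y - x) + p x * (y - x) ^ 2 / 2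
         + (u' s - u' x - p x * (s - x)) * (y - x)) as -> by lra.
       replace (u' s) with (u' x + p r * (s - x)) by lra. field. }
  replace (M * Rabs (y - x) ^ 3) with
    (M * Rabs (y - x) * Rabs (y - x) * Rabs (y - x)) by ring.
  repeat apply Rabs_mult_le; auto; lra.
Qed.

Lemma first_order_taylor (u u' p : R -> R) (x y M : R) :
  continuity u -> continuity u' ->
  0 < x < 1 -> 0 <= y <= 1 -> x < y ->
  (forall t, 0 < t < 1 -> is_derive u t (u' t)) ->
  (forall t, 0 < t < 1 -> is_derive u' t (p t)) ->
  (forall t, x < t < y -> Rabs (p t) <= M) ->
  Rabs (u y - u x - u' x * (y - x)) <= M * (y - x) ^ 2.
Proof.
  intros Cu Cu' Hx Hy Hxy Du Du' HM.
  destruct (mvt_open u u' x y Hxy) as [s [Hs Es]]; auto.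
  { intros t Ht. apply Du; lra. }
  destruct (mvt_open u' p x s) as [r [Hr Er]]; auto; [lra| |].
  { intros t Ht. apply Du'; lra. }
  replace (u y - u x - u' x * (y - x)) with (p r * (s - x) * (y - x)).
  2: { rewrite Es. rewrite <- Er. ring. }
  replace (M * (y - x) ^ 2) with (M * (y - x) * (y - x)) by ring.
  repeat apply Rabs_mult_le.
  - apply HM; lra.
  - rewrite Rabs_pos_eq; lra.
  - rewrite Rabs_pos_eq; lra.
Qed.

(** The truncation error at [x1] times the mean step [(x2 - x0) / 2]; the exact
    operator enters through [eps u'' + b u' = c u - f]. *)
Definition weighted_truncation (b c f : R -> R) (eps : R) (u : R -> R)
    (x0 x1 x2 : R) : R :=
  eps * ((u x2 - u x1) / (x2 - x1) - (u x1 - u x0) / (x1 - x0))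
  + b x1 * ((x2 - x0) / 2 * ((u x2 - u x1) / (x2 - x1)))
  - (x2 - x0) / 2 * (c x1 * u x1 - f x1).

(** Replacing both difference quotients by Taylor polynomials at [x1] costs
    [h^2 eps |u'''|] in the diffusion term and [h^2 |u''|] in the convection term;
    as the steps increase, [h = x2 - x1] is the larger of the two. *)
Lemma truncation_smooth b b' c c' f f' beta B eps K u u' x0 x1 x2 :
  coefficients b b' c c' f f' beta B -> 0 < eps ->
  solves b c f eps u u' -> 0 < K ->
  solution_estimates b c f beta eps K u u' ->
  0 <= x0 -> x0 < x1 -> x1 < x2 -> x2 <= 1 -> x1 - x0 <= x2 - x1 ->
  Rabs (weighted_truncation b c f eps u x0 x1 x2)
  <= (2 + B) * K * (x2 - x1) ^ 2 * (1 + layer beta eps x0 / eps ^ 2).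
Proof.
  intros D He S HK Est H0 H01 H12 H2 Hh.
  pose proof (coeff_beta D) as Hbeta.
  set (p := curvature b c f eps u u').
  set (p' := curvature' b b' c c' f' eps u u' p).
  set (L := K * (1 + layer beta eps x0 / eps ^ 2)).
  assert (Hx1 : 0 < x1 < 1) by lra.
  assert (Dp : forall t, 0 < t < 1 -> is_derive p t (p' t)).
  { apply (curvature_derive b b' c c' f f' beta B eps u u' D He S). }
  assert (Mono : forall t, x0 <= t ->
    K * (1 + layer beta eps t / eps ^ 2) <= L).
  { intros t Ht. unfold L. apply Rmult_le_compat_l; [lra|].
    apply Rplus_le_compat_l. apply Rmult_le_compat_r.
    - left. apply Rinv_0_lt_compat, pow_lt, He.
    - apply layer_decr; auto. }
  assert (Bp' : forall t, x0 < t < x2 -> Rabs (p' t) <= L / eps).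
  { intros t Ht. destruct (est_curvature' Est t ltac:(lra))
      as [d [Dd Hd]].
    assert (p' t = d) as ->.
    { rewrite <- (is_derive_unique _ _ _ (Dp t ltac:(lra))).
      apply is_derive_unique, Dd. }
    apply Rmult_le_reg_l with eps; [lra|].
    replace (eps * (L / eps)) with L by (field; lra).
    eapply Rle_trans; [exact Hd|apply Mono; lra]. }
  assert (Bp : forall t, x0 < t < x2 -> Rabs (p t) <= L).
  { intros t Ht. eapply Rle_trans;
      [apply (est_curvature Est t); lra|apply Mono; lra]. }
  pose proof (curvature_cont b b' c c' f f' beta B eps u u' D S) as Cp.
  fold p in Cp.
  pose proof (sol_cont S) as Cu.
  pose proof (sol_cont' S) as Cu'.
  pose proof (sol_derive S) as Du.
  pose proof (sol_derive2 S) as Du'.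
  assert (TR : Rabs (u x2 - u x1 - u' x1 * (x2 - x1)
      - p x1 * (x2 - x1) ^ 2 / 2) <= L / eps * Rabs (x2 - x1) ^ 3).
  { apply (second_order_taylor u u' p p'); auto; try lra.
    intros t Ht. apply Bp'.
    rewrite Rmin_left, Rmax_right in Ht by lra. lra. }
  assert (TL : Rabs (u x0 - u x1 - u' x1 * (x0 - x1)
      - p x1 * (x0 - x1) ^ 2 / 2) <= L / eps * Rabs (x0 - x1) ^ 3).
  { apply (second_order_taylor u u' p p'); auto; try lra.
    intros t Ht. apply Bp'.
    rewrite Rmin_right, Rmax_left in Ht by lra. lra. }
  assert (TF : Rabs (u x2 - u x1 - u' x1 * (x2 - x1)) <= L * (x2 - x1) ^ 2).
  { apply (first_order_taylor u u' p); auto; try lra.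
    intros t Ht. apply Bp. lra. }
  set (h := x2 - x1) in *. set (k := x1 - x0) in *.
  replace (x0 - x1) with (- k) in TL by (unfold k; ring).
  rewrite Rabs_Ropp, (Rabs_pos_eq k) in TL by (unfold k; lra).
  rewrite (Rabs_pos_eq h) in TR by (unfold h; lra).
  assert (Hh0 : 0 < h) by (unfold h; lra).
  assert (Hk0 : 0 < k) by (unfold k; lra).
  set (rR := u x2 - u x1 - u' x1 * h - p x1 * h ^ 2 / 2) in *.
  set (rL := u x0 - u x1 - u' x1 * - k - p x1 * (- k) ^ 2 / 2) in *.
  set (rF := u x2 - u x1 - u' x1 * h) in *.
  assert (HL : 0 <= L).
  { eapply Rle_trans; [apply Rabs_pos|apply (Bp x1); lra]. }
  (* The equation at [x1] cancels every term that is not a remainder. *)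
  replace (weighted_truncation b c f eps u x0 x1 x2) with
    (eps * (rR / h) + eps * (rL / k) + b x1 * ((h + k) / 2 * (rF / h))).
  2: { unfold weighted_truncation. fold h. fold k.
       replace (x2 - x0) with (h + k) by (unfold h, k; ring).
       replace (c x1 * u x1 - f x1) with (eps * p x1 + b x1 * u' x1)
         by (unfold p, curvature; field; lra).
       unfold rR, rL, rF. field. lra. }
  assert (Div : forall r d C, 0 < d -> Rabs r <= C * d -> Rabs (r / d) <= C).
  { intros r d C Hd Hr. unfold Rdiv. rewrite Rabs_mult.
    rewrite (Rabs_pos_eq (/ d)) by (left; apply Rinv_0_lt_compat, Hd).
    apply Rmult_le_reg_r with d; [exact Hd|].
    rewrite Rmult_assoc, Rinv_l by lra. lra. }
  assert (H1 : Rabs (eps * (rR / h)) <= L * h ^ 2).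
  { replace (L * h ^ 2) with (eps * (L / eps * h ^ 2)) by (field; lra).
    apply Rabs_mult_le; [rewrite Rabs_pos_eq; lra|].
    apply Div; [exact Hh0|]. eapply Rle_trans; [exact TR|]. right; ring. }
  assert (H2' : Rabs (eps * (rL / k)) <= L * k ^ 2).
  { replace (L * k ^ 2) with (eps * (L / eps * k ^ 2)) by (field; lra).
    apply Rabs_mult_le; [rewrite Rabs_pos_eq; lra|].
    apply Div; [exact Hk0|]. eapply Rle_trans; [exact TL|]. right; ring. }
  assert (H3 : Rabs (b x1 * ((h + k) / 2 * (rF / h))) <= B * (h * (L * h))).
  { pose proof (coeff_b_range D x1 ltac:(lra)).
    apply Rabs_mult_le; [rewrite Rabs_pos_eq; lra|].
    apply Rabs_mult_le; [rewrite Rabs_pos_eq; lra|].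
    apply Div; [exact Hh0|]. eapply Rle_trans; [exact TF|]. right; ring. }
  assert (k ^ 2 <= h ^ 2) by nra.
  assert (L * k ^ 2 <= L * h ^ 2) by (apply Rmult_le_compat_l; lra).
  eapply Rle_trans.
  { apply Rabs_plus_le; [apply Rabs_plus_le|]; eassumption. }
  replace ((2 + B) * K * h ^ 2 * (1 + layer beta eps x0 / eps ^ 2)) with
    (2 * (L * h ^ 2) + B * (h * (L * h))) by (unfold L; ring).
  lra.
Qed.

(** Each term is bounded separately: [eps] times a difference quotient is [eps]
    times a slope, [u x2 - u x1] is the integral of the slope bound, and the
    residual [c u - f] is bounded. No factor [1 / eps] survives. *)
Lemma truncation_rough b b' c c' f f' beta B eps K u u' x0 x1 x2 :
  coefficients b b' c c' f f' beta B -> 0 < eps ->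
  solves b c f eps u u' -> 0 < K ->
  solution_estimates b c f beta eps K u u' ->
  0 <= x0 -> x0 < x1 -> x1 < x2 -> x2 <= 1 -> x1 - x0 <= x2 - x1 ->
  Rabs (weighted_truncation b c f eps u x0 x1 x2)
  <= (2 + B + B / beta) * K * (x2 - x1 + eps + layer beta eps x0).
Proof.
  intros D He S HK Est H0 H01 H12 H2 Hh.
  pose proof (coeff_beta D) as Hbeta.
  pose proof (coeff_B D) as HB.
  pose proof (sol_cont S) as Cu.
  pose proof (sol_derive S) as Du.
  assert (Q : forall s t, x0 <= s -> s < t -> t <= x2 ->
    Rabs (eps * ((u t - u s) / (t - s))) <= K * (eps + layer beta eps x0)).
  { intros s t Hs Hst Ht.
    destruct (mvt_open u u' s t Hst Cu) as [r [Hr Er]].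
    { intros r Hr. apply Du. lra. }
    replace ((u t - u s) / (t - s)) with (u' r) by (rewrite Er; field; lra).
    replace (K * (eps + layer beta eps x0)) with
      (eps * (K * (1 + layer beta eps x0 / eps))) by (field; lra).
    apply Rabs_mult_le; [rewrite Rabs_pos_eq; lra|].
    eapply Rle_trans; [apply (est_slope Est r); lra|].
    apply Rmult_le_compat_l; [lra|]. apply Rplus_le_compat_l.
    apply Rmult_le_compat_r; [left; apply Rinv_0_lt_compat, He|].
    apply layer_decr; auto; lra. }
  assert (I : Rabs (u x2 - u x1) <= K * (x2 - x1) + K / beta * layer beta eps x0).
  { eapply Rle_trans.
    - apply (increment_le u u'
        (fun t => K * t - K / beta * layer beta eps t)
        (fun t => K * (1 + layer beta eps t / eps))); auto.
      + lra.
      + apply continuity_minus; [intros t; reg|].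
        apply continuity_mult; [intros t; reg|apply layer_cont, He].
      + intros t Ht. apply Du; lra.
      + intros t _. pose proof (layer_derive beta eps t He) as DL.
        auto_derive; [repeat split; eexists; eassumption|].
        rewrite (Derive_eq _ _ _ DL). field; lra.
      + intros t Ht. apply (est_slope Est t); lra.
    - pose proof (layer_pos beta eps x2).
      pose proof (layer_decr beta eps x0 x1 Hbeta He ltac:(lra)).
      assert (0 < K / beta) by (apply Rdiv_lt_0_compat; lra). nra. }
  set (h := x2 - x1) in *. set (E := layer beta eps x0) in *.
  assert (Hh0 : 0 < h) by (unfold h; lra).
  assert (HE : 0 < E) by apply layer_pos.
  replace (weighted_truncation b c f eps u x0 x1 x2) with
    (eps * ((u x2 - u x1) / h) - eps * ((u x1 - u x0) / (x1 - x0))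
     + b x1 * ((x2 - x0) / 2 / h * (u x2 - u x1))
     - (x2 - x0) / 2 * (c x1 * u x1 - f x1)).
  2: { unfold weighted_truncation. fold h. field. lra. }
  eapply Rle_trans.
  { apply Rabs_minus_le; [apply Rabs_plus_le; [apply Rabs_minus_le|]|].
    - apply Q; lra.
    - apply Q; lra.
    - apply Rabs_mult_le with (X := B).
      + pose proof (coeff_b_range D x1 ltac:(lra)).
        rewrite Rabs_pos_eq; lra.
      + apply Rabs_mult_le with (X := 1); [|exact I].
        rewrite Rabs_pos_eq.
        * apply Rmult_le_reg_r with h; [lra|].
          replace ((x2 - x0) / 2 / h * h) with ((x2 - x0) / 2) by (field; lra).
          unfold h in *; lra.
        * apply Rmult_le_pos; [lra|left; apply Rinv_0_lt_compat; lra].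
    - apply Rabs_mult_le with (X := h).
      + rewrite Rabs_pos_eq; unfold h in *; lra.
      + apply (est_residual Est x1); lra. }
  fold E.
  assert (0 < K / beta) by (apply Rdiv_lt_0_compat; lra).
  replace (B / beta * K) with (B * (K / beta)) by (field; lra).
  replace ((2 + B + B / beta) * K) with (2 * K + B * K + B * (K / beta))
    by (field; lra).
  assert (0 < B * K) by (apply Rmult_lt_0_compat; lra).
  assert (0 < B * (K / beta)) by (apply Rmult_lt_0_compat; lra).
  nra.
Qed.

(** * Stability of the upwind scheme in the weighted l1 norm *)

Definition upwind (eps : R) (b c x W : nat -> R) (i : nat) : R :=
  - eps * D2 x W i - b i * D1 x W i + c i * W i.

Lemma leftmost_minimum (p : nat -> R) (n : nat) :
  exists k, (k <= n)%nat /\ (forall j, (j <= n)%nat -> p k <= p j)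
    /\ (forall j, (j < k)%nat -> p k < p j).
Proof.
  induction n as [|n [k [Hk [Hmin Hlt]]]].
  - exists 0%nat. split; [lia|split].
    + intros j Hj. replace j with 0%nat by lia. lra.
    + intros j Hj. lia.
  - destruct (Rle_or_lt (p k) (p (S n))) as [H|H].
    + exists k. split; [lia|split; [|exact Hlt]].
      intros j Hj. destruct (Nat.eq_dec j (S n)) as [->|Hne]; [exact H|].
      apply Hmin. lia.
    + exists (S n). split; [lia|split].
      * intros j Hj. destruct (Nat.eq_dec j (S n)) as [->|Hne]; [lra|].
        specialize (Hmin j ltac:(lia)). lra.
      * intros j Hj. specialize (Hmin j ltac:(lia)). lra.
Qed.

(** At the leftmost minimum the backward difference is strictly negative, hence
    [D2 > 0] there, and a negative minimum would make the operator negative. *)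
Lemma discrete_maximum_principle (eps : R) (b c x p : nat -> R) (N : nat) :
  0 < eps -> (forall i, (1 <= i <= N)%nat -> 0 < step x i) ->
  (forall i, (1 <= i <= N - 1)%nat -> 0 <= b i /\ 0 <= c i) ->
  (forall i, (1 <= i <= N - 1)%nat -> 0 <= upwind eps b c x p i) ->
  0 <= p 0%nat -> 0 <= p N -> forall i, (i <= N)%nat -> 0 <= p i.
Proof.
  intros He Hs Hbc Hop H0 HN i Hi.
  destruct (leftmost_minimum p N) as [k [Hk [Hmin Hlt]]].
  destruct (Rle_or_lt 0 (p i)) as [|Hneg]; [assumption|exfalso].
  assert (Hpk : p k < 0) by (specialize (Hmin i Hi); lra).
  assert (k <> 0%nat) by (intros ->; lra).
  assert (k <> N) by (intros ->; lra).
  assert (Hk1 : (1 <= k <= N - 1)%nat) by lia.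
  specialize (Hop k Hk1). destruct (Hbc k Hk1) as [Hb Hc].
  pose proof (Hs k ltac:(lia)) as S1.
  pose proof (Hs (k + 1)%nat ltac:(lia)) as S2.
  pose proof (Hmin (k + 1)%nat ltac:(lia)) as Hr.
  pose proof (Hlt (k - 1)%nat ltac:(lia)) as Hl.
  unfold upwind, D2, D1, hbar in Hop.
  assert (Q1 : 0 <= (p (k + 1)%nat - p k) / step x (k + 1)).
  { apply Rmult_le_pos; [lra|left; apply Rinv_0_lt_compat; lra]. }
  assert (Q2 : 0 < (p (k - 1)%nat - p k) / step x k).
  { apply Rdiv_lt_0_compat; lra. }
  replace ((p k - p (k - 1)%nat) / step x k) with
    (- ((p (k - 1)%nat - p k) / step x k)) in Hop by (field; lra).
  set (A := (p (k + 1)%nat - p k) / step x (k + 1)) in *.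
  set (Z := (p (k - 1)%nat - p k) / step x k) in *.
  assert (Hi' : 0 < / ((step x k + step x (k + 1)) / 2)).
  { apply Rinv_0_lt_compat. lra. }
  assert (0 < / ((step x k + step x (k + 1)) / 2) * (A - - Z)).
  { apply Rmult_lt_0_compat; lra. }
  assert (0 <= b k * A) by (apply Rmult_le_pos; lra).
  assert (c k * p k <= 0) by nra.
  nra.
Qed.

(** The solution of [eps (Y_i - Y_{i-1}) + b_i hb_i Y_i = G_i], [Y_0 = 0]: the
    equation that the barrier [W] with [D1 W = - Y] must satisfy. *)
Fixpoint flux (eps : R) (b hb G : nat -> R) (i : nat) : R :=
  match i with
  | O => 0
  | S j => (eps * flux eps b hb G j + G (S j)) / (eps + b (S j) * hb (S j))
  end.

Fixpoint flux_potential (x Y : nat -> R) (i : nat) : R :=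
  match i with
  | O => 0
  | S j => flux_potential x Y j + step x (S j) * Y j
  end.

(** The barrier is [W_i = V_N - V_i] with [V] the potential of [flux]. Summing
    the recursion for the flux gives [sum_i b_i hbar_i Y_i <= sum_i G_i], and
    [step_{i+1} <= 2 hbar_i] turns this into a bound on [V_N], hence on [W]. As
    [W >= 0], the reaction term only helps. *)
Lemma upwind_stability (eps beta : R) (b c x v G : nat -> R) (N : nat) :
  (1 <= N)%nat -> 0 < eps -> 0 < beta ->
  (forall i, (1 <= i <= N)%nat -> 0 < step x i) ->
  (forall i, (1 <= i <= N - 1)%nat -> beta <= b i /\ 0 <= c i) ->
  (forall i, 0 <= G i) -> v 0%nat = 0 -> v N = 0 ->
  (forall i, (1 <= i <= N - 1)%nat ->
     Rabs (hbar x i * upwind eps b c x v i) <= G i) ->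
  forall i, (i <= N)%nat ->
    Rabs (v i) <= 2 / beta * sum_f_R0 G (N - 1).
Proof.
  intros HN He Hbeta Hs Hbc HG Hv0 HvN Hop.
  set (Y := flux eps b (hbar x) G).
  set (V := flux_potential x Y).
  set (W := fun i => V N - V i).
  assert (Hhb : forall i, (1 <= i <= N - 1)%nat ->
    0 < hbar x i /\ step x (S i) <= 2 * hbar x i).
  { intros i Hi. pose proof (Hs i ltac:(lia)).
    pose proof (Hs (i + 1)%nat ltac:(lia)).
    unfold hbar. replace (S i) with (i + 1)%nat by lia. lra. }
  assert (YS : forall i, (S i <= N - 1)%nat ->
    eps * Y (S i) + b (S i) * hbar x (S i) * Y (S i) = eps * Y i + G (S i)).
  { intros i Hi. destruct (Hhb (S i) ltac:(lia)) as [Hh _].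
    destruct (Hbc (S i) ltac:(lia)) as [Hb _].
    assert (0 < b (S i) * hbar x (S i)) by (apply Rmult_lt_0_compat; lra).
    unfold Y; simpl. field. lra. }
  assert (Y0 : forall i, (i <= N - 1)%nat -> 0 <= Y i).
  { induction i as [|i IH]; intros Hi; [unfold Y; simpl; lra|].
    destruct (Hhb (S i) ltac:(lia)) as [Hh _].
    destruct (Hbc (S i) ltac:(lia)) as [Hb _].
    assert (0 < b (S i) * hbar x (S i)) by (apply Rmult_lt_0_compat; lra).
    specialize (IH ltac:(lia)). specialize (YS i Hi). specialize (HG (S i)).
    nra. }
  assert (VS : forall n, (n <= N - 1)%nat ->
    eps * Y n + beta / 2 * V (S n) <= sum_f_R0 G n).
  { induction n as [|n IH]; intros Hn.
    - unfold V, Y; simpl. specialize (HG 0%nat). lra.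
    - specialize (IH ltac:(lia)). specialize (YS n Hn).
      destruct (Hhb (S n) ltac:(lia)) as [Hh Hh2].
      destruct (Hbc (S n) ltac:(lia)) as [Hb _].
      specialize (Y0 (S n) Hn).
      change (V (S (S n))) with (V (S n) + step x (S (S n)) * Y (S n)).
      rewrite tech5.
      assert (step x (S (S n)) * Y (S n) <= 2 * hbar x (S n) * Y (S n))
        by (apply Rmult_le_compat_r; lra).
      assert (beta * (hbar x (S n) * Y (S n))
              <= b (S n) * (hbar x (S n) * Y (S n))).
      { apply Rmult_le_compat_r; [apply Rmult_le_pos|]; lra. }
      nra. }
  assert (Vmono : forall n m, (n <= m <= N)%nat -> V n <= V m).
  { intros n m [Hnm Hm]. induction Hnm as [|m Hnm IH]; [lra|].
    specialize (IH ltac:(lia)).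
    change (V (S m)) with (V m + step x (S m) * Y m).
    pose proof (Hs (S m) ltac:(lia)). pose proof (Y0 m ltac:(lia)).
    assert (0 <= step x (S m) * Y m) by (apply Rmult_le_pos; lra). lra. }
  assert (Wop : forall i, (1 <= i <= N - 1)%nat ->
    G i <= hbar x i * upwind eps b c x W i).
  { intros i Hi. destruct i as [|i]; [lia|].
    destruct (Hhb (S i) Hi) as [Hh _]. destruct (Hbc (S i) Hi) as [Hb Hc].
    pose proof (Hs (S i) ltac:(lia)) as S1.
    pose proof (Hs (S (S i)) ltac:(lia)) as S2.
    unfold upwind, D2, D1.
    replace (S i + 1)%nat with (S (S i)) by lia.
    replace (S i - 1)%nat with i by lia.
    replace ((W (S (S i)) - W (S i)) / step x (S (S i))) with (- Y (S i)).
    2: { unfold W.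
         change (V (S (S i))) with (V (S i) + step x (S (S i)) * Y (S i)).
         field. lra. }
    replace ((W (S i) - W i) / step x (S i)) with (- Y i).
    2: { unfold W. change (V (S i)) with (V i + step x (S i) * Y i).
         field. lra. }
    replace (hbar x (S i) * (- eps * (/ hbar x (S i) * (- Y (S i) - - Y i))
      - b (S i) * - Y (S i) + c (S i) * W (S i)))
      with (G (S i) + hbar x (S i) * (c (S i) * W (S i))).
    2: { replace (G (S i)) with
           (eps * Y (S i) + b (S i) * hbar x (S i) * Y (S i) - eps * Y i)
           by (rewrite (YS i ltac:(lia)); ring).
         field. lra. }
    assert (0 <= W (S i)).
    { unfold W. pose proof (Vmono (S i) N ltac:(lia)). lra. }
    assert (0 <= hbar x (S i) * (c (S i) * W (S i))).
    { apply Rmult_le_pos; [lra|apply Rmult_le_pos; lra]. }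
    lra. }
  assert (W0 : forall i, (i <= N)%nat -> 0 <= W i).
  { intros i Hi. unfold W. pose proof (Vmono i N ltac:(lia)). lra. }
  assert (WB : forall i, (i <= N)%nat ->
    W i <= 2 / beta * sum_f_R0 G (N - 1)).
  { intros i Hi. pose proof (Vmono 0%nat i ltac:(lia)) as Hi0.
    change (V 0%nat) with 0 in Hi0.
    pose proof (VS (N - 1)%nat ltac:(lia)) as HV.
    replace (S (N - 1)) with N in HV by lia.
    pose proof (Y0 (N - 1)%nat ltac:(lia)).
    assert (0 <= eps * Y (N - 1)%nat) by (apply Rmult_le_pos; lra).
    apply Rmult_le_reg_l with (beta / 2); [lra|].
    replace (beta / 2 * (2 / beta * sum_f_R0 G (N - 1))) with
      (sum_f_R0 G (N - 1)) by (field; lra).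
    unfold W. nra. }
  assert (Cmp : forall s, s = 1 \/ s = -1 -> forall i, (i <= N)%nat ->
    0 <= W i + s * v i).
  { intros s Hsg. apply (discrete_maximum_principle eps b c x
      (fun i => W i + s * v i) N); auto.
    - intros i Hi. destruct (Hbc i Hi). lra.
    - intros i Hi. destruct (Hhb i Hi) as [Hh _].
      specialize (Wop i Hi). specialize (Hop i Hi).
      apply Rabs_le_between in Hop.
      apply Rmult_le_reg_l with (hbar x i); [exact Hh|].
      rewrite Rmult_0_r.
      replace (hbar x i * upwind eps b c x (fun i0 => W i0 + s * v i0) i)
        with (hbar x i * upwind eps b c x W i
              + s * (hbar x i * upwind eps b c x v i)).
      2: { unfold upwind, D2, D1, Rdiv. ring. }
      destruct Hsg as [-> | ->]; lra.
    - rewrite Hv0. specialize (W0 0%nat ltac:(lia)). lra.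
    - rewrite HvN. specialize (W0 N ltac:(lia)). lra. }
  intros i Hi. pose proof (Cmp 1 (or_introl eq_refl) i Hi).
  pose proof (Cmp (-1) (or_intror eq_refl) i Hi).
  specialize (WB i Hi). apply Rabs_le. lra.
Qed.

(** * The mesh *)

Record mesh_parameters (a q eps : R) : Prop := {
  par_q : 0 < q < 1;
  par_a : 0 < a;
  par_eps : 0 < eps;
  par_small : a * eps < q
}.

Arguments par_q {a q eps}.
Arguments par_eps {a q eps}.

(** The tangency condition at the contact point, cleared of denominators. *)
Lemma alpha_quadratic (a q eps : R) : mesh_parameters a q eps ->
  a * eps * (q - alpha a q eps ^ 2) = (q - alpha a q eps) ^ 2.
Proof.
  intros [Hq Ha He Hs]. unfold alpha.
  set (d := a * eps) in *.
  assert (Hd : 0 < d) by (apply Rmult_lt_0_compat; lra).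
  set (r := sqrt (d * q * (1 - q + d))).
  assert (Hr : r * r = d * q * (1 - q + d)).
  { apply sqrt_sqrt. repeat apply Rmult_le_pos; lra. }
  apply Rmult_eq_reg_r with ((1 + d) ^ 2); [|apply pow_nonzero; lra].
  replace (d * (q - ((q - r) / (1 + d)) ^ 2) * (1 + d) ^ 2) with
    (d * q * (1 + d) ^ 2 - d * (q * q - 2 * q * r + r * r)) by (field; lra).
  replace ((q - (q - r) / (1 + d)) ^ 2 * (1 + d) ^ 2) with
    (q * q * d * d + 2 * q * d * r + r * r) by (field; lra).
  rewrite Hr. ring.
Qed.

Lemma alpha_range (a q eps : R) : mesh_parameters a q eps ->
  0 < alpha a q eps < q.
Proof.
  intros [Hq Ha He Hs]. unfold alpha.
  set (d := a * eps) in *.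
  assert (Hd : 0 < d) by (apply Rmult_lt_0_compat; lra).
  set (r := sqrt (d * q * (1 - q + d))).
  assert (Hp : 0 < d * q * (1 - q + d)).
  { repeat apply Rmult_lt_0_compat; lra. }
  assert (Hr : r * r = d * q * (1 - q + d)) by (apply sqrt_sqrt; lra).
  assert (Hr0 : 0 < r) by (apply sqrt_lt_R0, Hp).
  assert (Hrq : r < q).
  { assert (r * r < q * q); [|nra]. rewrite Hr.
    replace (d * q * (1 - q + d)) with (q * (d * (1 - q + d))) by ring.
    apply Rmult_lt_compat_l; nra. }
  split.
  - apply Rdiv_lt_0_compat; lra.
  - apply Rmult_lt_reg_r with (1 + d); [lra|].
    replace ((q - r) / (1 + d) * (1 + d)) with (q - r) by (field; lra). nra.
Qed.

(** The contact point lies at a distance of order [sqrt eps] from the pole [q] of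
    [psi]. The lower bound limits the mesh steps; the upper bound makes the layer
    function negligible beyond the contact point. *)
Lemma alpha_gap (a q eps : R) : mesh_parameters a q eps ->
  a * eps * q * (1 - q) / 4 <= (q - alpha a q eps) ^ 2 <= 4 * (a * eps).
Proof.
  intros P. pose proof (alpha_range a q eps P) as R0.
  destruct P as [Hq Ha He Hs]. revert R0. unfold alpha.
  set (d := a * eps) in *.
  assert (Hd : 0 < d) by (apply Rmult_lt_0_compat; lra).
  set (r := sqrt (d * q * (1 - q + d))).
  assert (Hp : 0 < d * q * (1 - q + d)).
  { repeat apply Rmult_lt_0_compat; lra. }
  assert (Hr : r * r = d * q * (1 - q + d)) by (apply sqrt_sqrt; lra).
  assert (Hr0 : 0 < r) by (apply sqrt_lt_R0, Hp).
  set (g := q - (q - r) / (1 + d)). intros R0.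
  assert (Hg : g * (1 + d) = q * d + r) by (unfold g; field; lra).
  assert (Hg0 : 0 < g) by (unfold g; lra).
  assert (Hdq : 0 < d * q) by (apply Rmult_lt_0_compat; lra).
  split.
  - assert (r <= 2 * g) by nra.
    assert (r * r <= 4 * (g * g)) by nra.
    assert (d * q * (1 - q) <= r * r) by (rewrite Hr; nra).
    simpl. lra.
  - assert (g <= q * d + r) by nra.
    assert (r * r <= d).
    { rewrite Hr. replace (d * q * (1 - q + d)) with (d * (q * (1 - q + d)))
        by ring. rewrite <- (Rmult_1_r d) at 3.
      apply Rmult_le_compat_l; nra. }
    assert (q * d * (q * d) <= d).
    { assert (q * d <= 1) by nra. assert (q * d <= d) by nra. nra. }
    assert (g * g <= (q * d + r) * (q * d + r)) by nra.
    assert (0 <= (q * d - r) * (q * d - r)) by apply Rle_0_sqr.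
    simpl. lra.
Qed.

(** Inverse distance to the pole [q], frozen beyond the contact point. It
    describes the mesh on both of its parts: [lambda' = a eps q density^2], and
    the layer function at [lambda t] is at most a constant times
    [exp (- beta a q density t)]. *)
Definition density (a q eps t : R) : R := / (q - Rmin t (alpha a q eps)).

Lemma density_pos (a q eps t : R) : mesh_parameters a q eps ->
  0 < density a q eps t.
Proof.
  intros P. pose proof (alpha_range a q eps P).
  pose proof (Rmin_r t (alpha a q eps)).
  apply Rinv_0_lt_compat. lra.
Qed.

Lemma density_le (a q eps t m : R) : mesh_parameters a q eps ->
  0 < m -> m <= q - Rmin t (alpha a q eps) -> density a q eps t <= / m.
Proof. intros P Hm H. apply Rinv_le_contravar; assumption. Qed.

Lemma lambda_left (a q eps t : R) : mesh_parameters a q eps ->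
  t <= alpha a q eps ->
  lambda a q eps t = a * eps * (q * density a q eps t - 1).
Proof.
  intros P Ht. pose proof (alpha_range a q eps P).
  unfold lambda, density, psi. destruct (Rle_dec t (alpha a q eps)); [|lra].
  rewrite Rmin_left by assumption. field. lra.
Qed.

Lemma lambda_right (a q eps t : R) : mesh_parameters a q eps ->
  alpha a q eps <= t ->
  lambda a q eps t = a * eps * (q * density a q eps t - 1)
    + a * eps * q * density a q eps t ^ 2 * (t - alpha a q eps).
Proof.
  intros P Ht. pose proof (alpha_range a q eps P) as R0.
  destruct (Req_dec t (alpha a q eps)) as [->|Hne].
  { rewrite (lambda_left a q eps) by (auto; lra). ring. }
  unfold lambda. destruct (Rle_dec t (alpha a q eps)); [lra|].
  unfold density. rewrite Rmin_right by assumption.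
  set (al := alpha a q eps) in *.
  replace (Derive (psi a q eps) al) with (a * eps * q * (/ (q - al)) ^ 2).
  2: { symmetry. apply is_derive_unique. unfold psi. auto_derive.
       - lra.
       - field. lra. }
  unfold psi. field. lra.
Qed.

(** Convexity of [lambda], with both one-sided slopes explicit. *)
Lemma lambda_increment (a q eps s t : R) : mesh_parameters a q eps -> s <= t ->
  a * eps * q * density a q eps s ^ 2 * (t - s)
    <= lambda a q eps t - lambda a q eps s
    <= a * eps * q * density a q eps t ^ 2 * (t - s).
Proof.
  intros P Hst. pose proof (alpha_range a q eps P) as R0.
  pose proof (density_pos a q eps s P) as Pi.
  pose proof (density_pos a q eps t P) as Pj.
  assert (Hdq : 0 < a * eps * q).
  { destruct P. repeat apply Rmult_lt_0_compat; lra. }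
  assert (Core : forall i j m l, 0 < i -> 0 <= m -> 0 <= l -> i <= j ->
    i ^ 2 * (m + l) <= i * j * m + j ^ 2 * l <= j ^ 2 * (m + l)).
  { intros i j m l Hi Hm Hl Hij.
    assert (i ^ 2 <= i * j) by nra. assert (i * j <= j ^ 2) by nra.
    assert (i ^ 2 * m <= i * j * m) by (apply Rmult_le_compat_r; lra).
    assert (i * j * m <= j ^ 2 * m) by (apply Rmult_le_compat_r; lra).
    assert (i ^ 2 * l <= j ^ 2 * l) by (apply Rmult_le_compat_r; lra).
    lra. }
  set (al := alpha a q eps) in *.
  assert (Main : exists m l, 0 <= m /\ 0 <= l /\ m + l = t - s /\
    density a q eps s <= density a q eps t /\
    lambda a q eps t - lambda a q eps s = a * eps * q *
      (density a q eps s * density a q eps t * m + density a q eps t ^ 2 * l)).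
  { destruct (Rle_or_lt t al) as [Ht|Ht]; [|destruct (Rle_or_lt s al) as [Hs|Hs]].
    - exists (t - s), 0.
      rewrite !(lambda_left a q eps) by (auto; unfold al in *; lra).
      unfold density in *; fold al in Pi, Pj |- *.
      rewrite !Rmin_left in * by lra.
      repeat split; try lra; [apply Rinv_le_contravar; lra|field; lra].
    - exists (al - s), (t - al).
      rewrite (lambda_left a q eps s), (lambda_right a q eps t)
        by (auto; unfold al in *; lra).
      unfold density in *; fold al in Pi, Pj |- *.
      rewrite (Rmin_left s), (Rmin_right t) in * by lra.
      repeat split; try lra; [apply Rinv_le_contravar; lra|field; lra].
    - exists 0, (t - s).
      rewrite !(lambda_right a q eps) by (auto; unfold al in *; lra).
      unfold density in *; fold al in Pi, Pj |- *.
      rewrite !Rmin_right in * by lra.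
      repeat split; lra. }
  destruct Main as [m [l [Hm [Hl [Hml [Hd E]]]]]].
  rewrite E, <- Hml.
  destruct (Core _ _ m l Pi Hm Hl Hd) as [C1 C2].
  split; rewrite (Rmult_assoc (a * eps * q)); apply Rmult_le_compat_l; lra.
Qed.

Lemma lambda_at_0 (a q eps : R) : mesh_parameters a q eps ->
  lambda a q eps 0 = 0.
Proof.
  intros P. pose proof (alpha_range a q eps P).
  rewrite (lambda_left a q eps) by (auto; lra).
  unfold density. rewrite Rmin_left by lra. destruct P. field. lra.
Qed.

Lemma lambda_at_1 (a q eps : R) : mesh_parameters a q eps ->
  lambda a q eps 1 = 1.
Proof.
  intros P. pose proof (alpha_range a q eps P) as R0.
  pose proof (alpha_quadratic a q eps P) as Q.
  pose proof (par_q P).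
  rewrite (lambda_right a q eps) by (auto; lra).
  unfold density. rewrite Rmin_right by lra.
  set (al := alpha a q eps) in *.
  replace (a * eps * (q * / (q - al) - 1)
    + a * eps * q * (/ (q - al)) ^ 2 * (1 - al))
    with (a * eps * (q - al ^ 2) / (q - al) ^ 2) by (field; lra).
  rewrite Q. field. lra.
Qed.

Lemma lambda_mono (a q eps s t : R) : mesh_parameters a q eps -> s < t ->
  lambda a q eps s < lambda a q eps t.
Proof.
  intros P Hst. destruct (lambda_increment a q eps s t P) as [H _]; [lra|].
  pose proof (density_pos a q eps s P).
  assert (0 < a * eps * q * density a q eps s ^ 2 * (t - s)); [|lra].
  destruct P. repeat apply Rmult_lt_0_compat; lra.
Qed.

Lemma lambda_steps_increase (a q eps t n : R) : mesh_parameters a q eps ->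
  0 < n ->
  lambda a q eps t < lambda a q eps (t + 1 / n)
  /\ lambda a q eps (t + 1 / n) < lambda a q eps (t + 2 / n)
  /\ lambda a q eps (t + 1 / n) - lambda a q eps t
     <= lambda a q eps (t + 2 / n) - lambda a q eps (t + 1 / n).
Proof.
  intros P Hn. assert (Hi : 0 < / n) by (apply Rinv_0_lt_compat, Hn).
  split; [|split]; try (apply lambda_mono; [exact P|unfold Rdiv; lra]).
  destruct (lambda_increment a q eps t (t + 1 / n) P) as [_ I1];
    [unfold Rdiv; lra|].
  destruct (lambda_increment a q eps (t + 1 / n) (t + 2 / n) P) as [I2 _];
    [unfold Rdiv; lra|].
  replace (t + 1 / n - t) with (/ n) in I1 by (field; lra).
  replace (t + 2 / n - (t + 1 / n)) with (/ n) in I2 by (field; lra).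
  lra.
Qed.

Lemma lambda_slope_bound (a q eps t : R) : mesh_parameters a q eps ->
  a * eps * q * density a q eps t ^ 2 <= 4 / (1 - q).
Proof.
  intros P. pose proof (alpha_range a q eps P) as R0.
  pose proof (alpha_gap a q eps P) as [G _].
  pose proof (density_pos a q eps t P) as D0.
  pose proof (Rmin_r t (alpha a q eps)).
  assert (D : density a q eps t <= / (q - alpha a q eps)).
  { apply density_le; auto; lra. }
  destruct P as [Hq Ha He Hs].
  set (g := q - alpha a q eps) in *.
  assert (Hg : 0 < g) by (unfold g; lra).
  assert (Hdq : 0 < a * eps * q) by (repeat apply Rmult_lt_0_compat; lra).
  apply Rle_trans with (a * eps * q * (/ g) ^ 2).
  { apply Rmult_le_compat_l; [lra|]. apply pow_incr. lra. }
  apply Rmult_le_reg_r with (g ^ 2 * (1 - q)).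
  { apply Rmult_lt_0_compat; [apply pow_lt|]; lra. }
  replace (a * eps * q * (/ g) ^ 2 * (g ^ 2 * (1 - q))) with
    (a * eps * q * (1 - q)) by (field; lra).
  replace (4 / (1 - q) * (g ^ 2 * (1 - q))) with (4 * g ^ 2) by (field; lra).
  lra.
Qed.

Lemma exp_neg_le (z : R) : z * exp (- z) <= 1.
Proof.
  pose proof (exp_ineq1_le z). pose proof (exp_pos (- z)).
  replace 1 with (exp z * exp (- z))
    by (rewrite <- exp_plus, Rplus_opp_r; apply exp_0).
  apply Rmult_le_compat_r; lra.
Qed.

Lemma pow4_exp_neg_le (z : R) : 0 <= z -> z ^ 4 * exp (- z) <= 256.
Proof.
  intros Hz. pose proof (exp_neg_le (z / 4)) as H.
  replace (exp (- z)) with (exp (- (z / 4)) ^ 4).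
  2: { simpl. rewrite Rmult_1_r, <- !exp_plus. f_equal. field. }
  replace (z ^ 4 * exp (- (z / 4)) ^ 4) with
    (256 * (z / 4 * exp (- (z / 4))) ^ 4) by field.
  assert ((z / 4 * exp (- (z / 4))) ^ 4 <= 1 ^ 4).
  { apply pow_incr. split; [|exact H].
    apply Rmult_le_pos; [lra|left; apply exp_pos]. }
  rewrite pow1 in *. lra.
Qed.

Lemma layer_on_mesh (a q eps beta t : R) : mesh_parameters a q eps -> 0 < beta ->
  layer beta eps (lambda a q eps t)
  <= exp (beta * a) * exp (- (beta * a * q * density a q eps t)).
Proof.
  intros P Hb. unfold layer. rewrite <- exp_plus. apply exp_mono.
  pose proof (par_eps P) as He.
  assert (L : a * eps * (q * density a q eps t - 1) <= lambda a q eps t).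
  { destruct (Rle_or_lt t (alpha a q eps)) as [H|H].
    - rewrite (lambda_left a q eps) by auto. lra.
    - rewrite (lambda_right a q eps) by (auto; lra).
      pose proof (density_pos a q eps t P).
      assert (0 <= a * eps * q * density a q eps t ^ 2
        * (t - alpha a q eps)); [|lra].
      destruct P. left. repeat apply Rmult_lt_0_compat; lra. }
  replace (beta * a + - (beta * a * q * density a q eps t)) with
    (- (beta * (a * eps * (q * density a q eps t - 1)) / eps)) by (field; lra).
  apply Ropp_le_contravar. apply Rmult_le_compat_r.
  - left. apply Rinv_0_lt_compat, He.
  - apply Rmult_le_compat_l; lra.
Qed.

(** The fourth power is what [h^2 / eps^2] costs, since [h] is of order
    [eps density^2 / N]. *)
Lemma layer_pow4_on_mesh (a q eps beta t : R) :
  mesh_parameters a q eps -> 0 < beta ->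
  density a q eps t ^ 4 * layer beta eps (lambda a q eps t)
  <= 256 * exp (beta * a) / (beta * a * q) ^ 4.
Proof.
  intros P Hb. pose proof (layer_on_mesh a q eps beta t P Hb) as L.
  pose proof (density_pos a q eps t P) as D0.
  set (y := density a q eps t) in *. set (k := beta * a * q) in *.
  assert (Hk : 0 < k).
  { unfold k. destruct P. repeat apply Rmult_lt_0_compat; lra. }
  pose proof (exp_pos (beta * a)).
  assert (Z : (k * y) ^ 4 * exp (- (k * y)) <= 256).
  { apply pow4_exp_neg_le. apply Rmult_le_pos; lra. }
  apply Rle_trans with (y ^ 4 * (exp (beta * a) * exp (- (k * y)))).
  { apply Rmult_le_compat_l; [left; apply pow_lt; exact D0|exact L]. }
  replace (y ^ 4 * (exp (beta * a) * exp (- (k * y)))) with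
    (exp (beta * a) / k ^ 4 * ((k * y) ^ 4 * exp (- (k * y)))) by (field; lra).
  replace (256 * exp (beta * a) / k ^ 4) with (exp (beta * a) / k ^ 4 * 256)
    by (field; lra).
  apply Rmult_le_compat_l; [|exact Z].
  apply Rmult_le_pos; [lra|left; apply Rinv_0_lt_compat, pow_lt, Hk].
Qed.

(** With [n] the number of mesh intervals, [t], [t + 1/n] and [t + 2/n] are the
    parameters of three consecutive nodes. If [alpha <= t], the layer function is
    of order [eps^2] at [t], and steps of length [C / n] are good enough. If
    [3 / n <= q - t], the density at [t + 2/n], which governs the step, is
    comparable with the density at [t], which governs the layer function. *)
Lemma mesh_step_resolves_layer (a q beta : R) : 0 < q < 1 -> 0 < a -> 0 < beta ->
  exists C, 0 < C /\ forall eps t n, mesh_parameters a q eps -> 0 < n ->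
    alpha a q eps <= t \/ 3 / n <= q - t ->
    (lambda a q eps (t + 2 / n) - lambda a q eps (t + 1 / n)) ^ 2
      * (1 + layer beta eps (lambda a q eps t) / eps ^ 2) <= C / n ^ 2.
Proof.
  intros Hq Ha Hb.
  set (S := 4 / (1 - q)).
  set (A := 256 * exp (beta * a) / (beta * a * q) ^ 4).
  assert (HS : 0 < S) by (apply Rdiv_lt_0_compat; lra).
  assert (HA : 0 < A).
  { apply Rdiv_lt_0_compat.
    - pose proof (exp_pos (beta * a)). lra.
    - apply pow_lt. repeat apply Rmult_lt_0_compat; lra. }
  exists (S ^ 2 + S ^ 2 * (16 * a ^ 2 * A) + 81 * a ^ 2 * q ^ 2 * A).
  assert (P1 : 0 < S ^ 2) by (apply pow_lt; lra).
  assert (Pa2 : 0 < a ^ 2) by (apply pow_lt; lra).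
  assert (Pq2 : 0 < q ^ 2) by (apply pow_lt; lra).
  assert (P2 : 0 < S ^ 2 * (16 * a ^ 2 * A)).
  { apply Rmult_lt_0_compat; [exact P1|].
    apply Rmult_lt_0_compat; [lra|exact HA]. }
  assert (Paq : 0 < 81 * a ^ 2 * q ^ 2).
  { apply Rmult_lt_0_compat; [lra|exact Pq2]. }
  assert (P3 : 0 < 81 * a ^ 2 * q ^ 2 * A).
  { apply Rmult_lt_0_compat; [exact Paq|exact HA]. }
  split; [lra|].
  intros eps t n P Hn Hcase.
  pose proof (par_eps P) as He.
  pose proof (alpha_range a q eps P) as R0.
  assert (Hin : 0 < / n) by (apply Rinv_0_lt_compat, Hn).
  assert (Hin2 : 0 < / n ^ 2) by (apply Rinv_0_lt_compat, pow_lt, Hn).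
  destruct (lambda_increment a q eps (t + 1 / n) (t + 2 / n) P) as [_ Hh].
  { unfold Rdiv; lra. }
  pose proof (lambda_mono a q eps (t + 1 / n) (t + 2 / n) P) as Hh0.
  specialize (Hh0 ltac:(unfold Rdiv; lra)).
  set (h := lambda a q eps (t + 2 / n) - lambda a q eps (t + 1 / n)) in *.
  assert (Hh0' : 0 < h) by (unfold h; lra). clear Hh0.
  replace (t + 2 / n - (t + 1 / n)) with (/ n) in Hh by (field; lra).
  pose proof (lambda_slope_bound a q eps (t + 2 / n) P) as Hs. fold S in Hs.
  pose proof (density_pos a q eps (t + 2 / n) P) as D2.
  pose proof (layer_pow4_on_mesh a q eps beta t P Hb) as HL. fold A in HL.
  pose proof (layer_pos beta eps (lambda a q eps t)) as HE.
  pose proof (density_pos a q eps t P) as D0.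
  set (E := layer beta eps (lambda a q eps t)) in *.
  set (y := density a q eps t) in *. set (w := density a q eps (t + 2 / n)) in *.
  assert (HhS : h <= S * / n).
  { eapply Rle_trans; [exact Hh|]. apply Rmult_le_compat_r; lra. }
  assert (Hh2 : h ^ 2 <= S ^ 2 * / n ^ 2).
  { replace (S ^ 2 * / n ^ 2) with ((S * / n) ^ 2) by (field; lra).
    apply pow_incr. lra. }
  assert (Hlay : h ^ 2 * (E / eps ^ 2)
    <= (S ^ 2 * (16 * a ^ 2 * A) + 81 * a ^ 2 * q ^ 2 * A) * / n ^ 2).
  { destruct (Rle_or_lt (alpha a q eps) t) as [Ht|Ht].
    - (* On the straight part [E] itself pays for [eps ^ -2], because
         [q - alpha] is of the order of [sqrt eps]. *)
      assert (Hi : / eps <= 4 * a * y ^ 2).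
      { destruct (alpha_gap a q eps P) as [_ G].
        unfold y, density. rewrite Rmin_right by exact Ht.
        set (g := q - alpha a q eps) in *.
        assert (Hg : 0 < g) by (unfold g; lra).
        apply Rmult_le_reg_r with (eps * g ^ 2).
        { apply Rmult_lt_0_compat; [|apply pow_lt]; lra. }
        replace (/ eps * (eps * g ^ 2)) with (g ^ 2) by (field; lra).
        replace (4 * a * (/ g) ^ 2 * (eps * g ^ 2)) with (4 * (a * eps))
          by (field; lra).
        exact G. }
      assert (HEe : E / eps ^ 2 <= 16 * a ^ 2 * A).
      { replace (E / eps ^ 2) with ((/ eps) ^ 2 * E) by (field; lra).
        apply Rle_trans with ((4 * a * y ^ 2) ^ 2 * E).
        - apply Rmult_le_compat_r; [lra|]. apply pow_incr.
          split; [left; apply Rinv_0_lt_compat, He|exact Hi].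
        - replace ((4 * a * y ^ 2) ^ 2 * E) with (16 * a ^ 2 * (y ^ 4 * E))
            by ring.
          apply Rmult_le_compat_l; [|exact HL].
          apply Rmult_le_pos; [lra|apply pow2_ge_0]. }
      apply Rle_trans with ((S ^ 2 * / n ^ 2) * (16 * a ^ 2 * A)).
      + apply Rmult_le_compat; try lra; [apply pow2_ge_0|].
        apply Rmult_le_pos; [lra|]. left. apply Rinv_0_lt_compat, pow_lt, He.
      + assert (0 < 81 * a ^ 2 * q ^ 2 * A * / n ^ 2)
          by (apply Rmult_lt_0_compat; lra).
        lra.
    - (* Over two mesh points the density grows at most by the factor 3. *)
      destruct Hcase as [Hc|Hc]; [lra|].
      assert (Hy : y = / (q - t)).
      { unfold y, density. rewrite Rmin_left; [reflexivity|lra]. }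
      assert (Hw : w <= 3 * y).
      { rewrite Hy.
        replace (3 * / (q - t)) with (/ ((q - t) / 3)) by (field; lra).
        apply density_le; auto; [lra|].
        pose proof (Rmin_l (t + 2 / n) (alpha a q eps)).
        unfold Rdiv in *. lra. }
      assert (Hh3 : h <= 9 * a * eps * q * y ^ 2 * / n).
      { eapply Rle_trans; [exact Hh|]. apply Rmult_le_compat_r; [lra|].
        replace (9 * a * eps * q * y ^ 2) with (a * eps * q * (3 * y) ^ 2)
          by ring.
        apply Rmult_le_compat_l; [|apply pow_incr; lra].
        left. repeat apply Rmult_lt_0_compat; lra. }
      apply Rle_trans with ((9 * a * eps * q * y ^ 2 * / n) ^ 2 * (E / eps ^ 2)).
      + apply Rmult_le_compat_r; [|apply pow_incr; lra].
        apply Rmult_le_pos; [lra|]. left. apply Rinv_0_lt_compat, pow_lt, He.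
      + replace ((9 * a * eps * q * y ^ 2 * / n) ^ 2 * (E / eps ^ 2)) with
          (81 * a ^ 2 * q ^ 2 * / n ^ 2 * (y ^ 4 * E)) by (field; lra).
        apply Rle_trans with (81 * a ^ 2 * q ^ 2 * / n ^ 2 * A).
        * apply Rmult_le_compat_l; [|exact HL].
          left. apply Rmult_lt_0_compat; [exact Paq|exact Hin2].
        * assert (0 < S ^ 2 * (16 * a ^ 2 * A) * / n ^ 2)
            by (apply Rmult_lt_0_compat; lra).
          lra. }
  unfold Rdiv at 2. lra.
Qed.

(** Closeness to the pole works in favour of the estimate: [q - t < 3 / n] bounds
    [q - alpha], hence [sqrt eps], and makes the density at [t] larger than
    [n / 3], hence the layer function small. *)
Lemma layer_small_near_transition (a q beta : R) :
  0 < q < 1 -> 0 < a -> 0 < beta ->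
  exists C, 0 < C /\ forall eps t n, mesh_parameters a q eps -> 1 <= n ->
    t < alpha a q eps -> q - t < 3 / n ->
    lambda a q eps (t + 2 / n) - lambda a q eps (t + 1 / n)
      + eps + layer beta eps (lambda a q eps t) <= C / n.
Proof.
  intros Hq Ha Hb.
  set (C1 := 4 / (1 - q)).
  set (C2 := 36 / (a * q * (1 - q))).
  set (C3 := 3 * exp (beta * a) / (beta * a * q)).
  assert (H1 : 0 < C1) by (apply Rdiv_lt_0_compat; lra).
  assert (Haq : 0 < a * q * (1 - q)).
  { repeat apply Rmult_lt_0_compat; lra. }
  assert (H2 : 0 < C2) by (apply Rdiv_lt_0_compat; lra).
  assert (Hk : 0 < beta * a * q) by (repeat apply Rmult_lt_0_compat; lra).
  assert (H3 : 0 < C3).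
  { apply Rdiv_lt_0_compat; [|lra]. pose proof (exp_pos (beta * a)). lra. }
  exists (C1 + C2 + C3). split; [lra|].
  intros eps t n P Hn Ht Hc.
  pose proof (par_eps P) as He.
  pose proof (alpha_range a q eps P) as R0.
  assert (Hin : 0 < / n) by (apply Rinv_0_lt_compat; lra).
  assert (Q1 : lambda a q eps (t + 2 / n) - lambda a q eps (t + 1 / n)
    <= C1 * / n).
  { destruct (lambda_increment a q eps (t + 1 / n) (t + 2 / n) P) as [_ Hh].
    { unfold Rdiv; lra. }
    replace (t + 2 / n - (t + 1 / n)) with (/ n) in Hh by (field; lra).
    eapply Rle_trans; [exact Hh|]. apply Rmult_le_compat_r; [lra|].
    apply lambda_slope_bound, P. }
  assert (Q2 : eps <= C2 * / n).
  { destruct (alpha_gap a q eps P) as [G _].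
    set (g := q - alpha a q eps) in *.
    assert (Hg : 0 < g < 3 / n) by (unfold g; lra).
    assert (Hg2 : g ^ 2 <= (3 / n) ^ 2) by (apply pow_incr; lra).
    assert (Hn2 : (3 / n) ^ 2 <= 9 * / n).
    { replace ((3 / n) ^ 2) with (9 * (/ n * / n)) by (field; lra).
      assert (/ n <= 1) by (rewrite <- Rinv_1; apply Rinv_le_contravar; lra).
      nra. }
    apply Rmult_le_reg_l with (a * q * (1 - q)); [exact Haq|].
    replace (a * q * (1 - q) * (C2 * / n)) with (36 * / n)
      by (unfold C2; field; lra).
    lra. }
  assert (Q3 : layer beta eps (lambda a q eps t) <= C3 * / n).
  { eapply Rle_trans; [apply (layer_on_mesh a q eps beta t P Hb)|].
    assert (Hy : density a q eps t = / (q - t)).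
    { unfold density. rewrite Rmin_left; [reflexivity|lra]. }
    rewrite Hy. set (k := beta * a * q) in *.
    assert (Hqt : 0 < q - t) by lra.
    set (z := k * / (q - t)).
    assert (Hz : 0 < z).
    { apply Rmult_lt_0_compat; [lra|apply Rinv_0_lt_compat; lra]. }
    pose proof (exp_neg_le z) as HZ.
    pose proof (exp_pos (beta * a)) as Hexp.
    assert (Hez : exp (- z) <= (q - t) / k).
    { apply Rmult_le_reg_l with z; [exact Hz|].
      replace (z * ((q - t) / k)) with 1 by (unfold z; field; lra). exact HZ. }
    assert (Hqk : (q - t) / k <= 3 / n / k).
    { apply Rmult_le_compat_r; [left; apply Rinv_0_lt_compat|]; lra. }
    replace (C3 * / n) with (exp (beta * a) * (3 / n / k))
      by (unfold C3; field; lra).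
    apply Rmult_le_compat_l; lra. }
  unfold Rdiv at 3. lra.
Qed.

Lemma count_in_window (z : R) (n : nat) :
  sum_f_R0 (fun i => if Rlt_dec z (INR i) then
                       if Rlt_dec (INR i) (z + 3) then 1 else 0 else 0) n
  <= 4.
Proof.
  set (F := fun i : nat => if Rlt_dec z (INR i) then
                       if Rlt_dec (INR i) (z + 3) then 1 else 0 else 0).
  (* This sharper bound is preserved when [n] grows; the bound 4 is not. *)
  assert (H : sum_f_R0 F n <= Rmax 0 (Rmin 4 (INR n + 1 - z))).
  { induction n as [|n IH].
    - unfold sum_f_R0, F. change (INR 0) with 0.
      unfold Rmax, Rmin. repeat destruct Rlt_dec; repeat destruct Rle_dec; lra.
    - rewrite tech5. rewrite S_INR. unfold F at 2. rewrite S_INR.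
      revert IH. unfold Rmax, Rmin.
      repeat destruct Rlt_dec; repeat destruct Rle_dec; lra. }
  eapply Rle_trans; [exact H|]. apply Rmax_lub; [lra|apply Rmin_l].
Qed.

(** * From functions on [0,1] to functions on the line *)

Definition clamp (x : R) : R := Rmax 0 (Rmin 1 x).

Definition extend (g : R -> R) (x : R) : R := g (clamp x).

Lemma clamp_range (x : R) : I01 (clamp x).
Proof.
  unfold I01, clamp. split; [apply Rmax_l|].
  apply Rmax_lub; [lra|apply Rmin_l].
Qed.

Lemma clamp_id (x : R) : 0 <= x <= 1 -> clamp x = x.
Proof. intros H. unfold clamp. rewrite Rmin_right, Rmax_right; lra. Qed.

Lemma clamp_contracts (x y : R) : Rabs (clamp x - clamp y) <= Rabs (x - y).
Proof.
  unfold clamp, Rmax, Rmin, Rabs.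
  destruct (Rle_dec 1 x), (Rle_dec 1 y);
    repeat (destruct Rle_dec || destruct Rcase_abs); lra.
Qed.

Lemma extend_id (g : R -> R) (x : R) : 0 <= x <= 1 -> extend g x = g x.
Proof. intros H. unfold extend. rewrite clamp_id by exact H. reflexivity. Qed.

Lemma extend_cont (g : R -> R) : continuous_on I01 g -> continuity (extend g).
Proof.
  intros Hg x. apply continuity_pt_filterlim.
  unfold extend. intros P HP.
  destruct (Hg (clamp x) (clamp_range x) P HP) as [d Hd].
  exists d. intros y Hy. apply Hd; [|apply clamp_range].
  eapply Rle_lt_trans; [apply clamp_contracts|exact Hy].
Qed.

Lemma D_in_is_derive (g g' : R -> R) (x : R) :
  0 < x < 1 -> D_in g g' I01 x -> is_derive (extend g) x (g' x).
Proof.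
  intros Hx HD. apply (is_derive_ext_loc g).
  { assert (Hr : 0 < Rmin x (1 - x)) by (apply Rmin_glb_lt; lra).
    exists (mkposreal _ Hr). intros y Hy. simpl in Hy.
    symmetry. apply extend_id.
    pose proof (Rmin_l x (1 - x)). pose proof (Rmin_r x (1 - x)).
    apply Rabs_lt_between in Hy.
    unfold minus, plus, opp in Hy; simpl in Hy. lra. }
  apply is_derive_Reals. intros e He.
  destruct (HD e He) as [d [Hd H]].
  assert (Hr : 0 < Rmin d (Rmin x (1 - x))).
  { repeat apply Rmin_glb_lt; lra. }
  exists (mkposreal _ Hr). intros h Hh0 Hh. simpl in Hh.
  pose proof (Rmin_l d (Rmin x (1 - x))). pose proof (Rmin_r d (Rmin x (1 - x))).
  pose proof (Rmin_l x (1 - x)). pose proof (Rmin_r x (1 - x)).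
  specialize (H (x + h)). unfold Rdist in H. simpl in H. unfold Rdist in H.
  replace (x + h - x) with h in H by ring. apply H.
  apply Rabs_lt_between in Hh as Hh'.
  split; [|lra]. split; [unfold I01; lra|lra].
Qed.

Lemma Ck01_continuous (k : nat) (g : R -> R) : Ck01 k g -> continuous_on I01 g.
Proof.
  destruct k as [|k]; [exact (fun H => H)|].
  intros [g' [HD _]] x Hx P [e HP].
  destruct (cont_deriv g g' I01 x (HD x Hx) e (cond_pos e)) as [d [Hd H]].
  exists (mkposreal d Hd). intros y Hy Hy1. apply HP.
  destruct (Req_dec y x) as [->|Hne].
  - apply ball_center.
  - apply (H y). split; [split|]; auto.
Qed.

Lemma Ck01_extend (k : nat) (g : R -> R) : Ck01 (S k) g ->
  exists g', Ck01 k g' /\ C1_inside (extend g) (extend g').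
Proof.
  intros H. pose proof (Ck01_continuous _ _ H) as Hc.
  destruct H as [g' [HD Hk]]. exists g'. split; [exact Hk|].
  constructor.
  - apply extend_cont, Hc.
  - apply extend_cont, (Ck01_continuous k), Hk.
  - intros x Hx. rewrite (extend_id g') by lra.
    apply D_in_is_derive; [exact Hx|]. apply HD. unfold I01. lra.
Qed.

Lemma continuity_bounded (g : R -> R) : continuity g ->
  exists M, 0 < M /\ forall x, 0 <= x <= 1 -> Rabs (g x) <= M.
Proof.
  intros Hg.
  destruct (continuity_ab_maj (fun x => Rabs (g x)) 0 1) as [m [Hm _]]; [lra| |].
  { intros x _. apply (continuity_pt_comp g Rabs);
      [apply Hg|apply Rcontinuity_abs]. }
  exists (Rabs (g m) + 1). split; [pose proof (Rabs_pos (g m)); lra|].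
  intros x Hx. specialize (Hm x Hx). lra.
Qed.

(** Compactness of [[0,1]] provides the common bound [B]. *)
Lemma coefficients_exist (b c f : R -> R) (beta : R) :
  Ck01 1 b -> Ck01 1 c -> Ck01 1 f -> 0 < beta ->
  (forall x, 0 <= x <= 1 -> beta <= b x) ->
  (forall x, 0 <= x <= 1 -> 0 <= c x) ->
  exists b' c' f' B,
    coefficients (extend b) b' (extend c) c' (extend f) f' beta B.
Proof.
  intros hb hc hf Hbeta Hb Hc.
  destruct (Ck01_extend 0 b hb) as [b' [_ Db]].
  destruct (Ck01_extend 0 c hc) as [c' [_ Dc]].
  destruct (Ck01_extend 0 f hf) as [f' [_ Df]].
  destruct (continuity_bounded _ (C1_cont Db)) as [M1 [P1 H1]].
  destruct (continuity_bounded _ (C1_cont' Db)) as [M2 [P2 H2]].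
  destruct (continuity_bounded _ (C1_cont Dc)) as [M3 [P3 H3]].
  destruct (continuity_bounded _ (C1_cont' Dc)) as [M4 [P4 H4]].
  destruct (continuity_bounded _ (C1_cont Df)) as [M5 [P5 H5]].
  destruct (continuity_bounded _ (C1_cont' Df)) as [M6 [P6 H6]].
  exists (extend b'), (extend c'), (extend f'), (M1 + M2 + M3 + M4 + M5 + M6).
  constructor; try assumption; try lra.
  - intros x Hx. specialize (H1 x Hx). apply Rabs_le_between in H1.
    specialize (Hb x Hx). rewrite (extend_id b x Hx) in *. lra.
  - intros x Hx. specialize (H3 x Hx). apply Rabs_le_between in H3.
    specialize (Hc x Hx). rewrite (extend_id c x Hx) in *. lra.
  - intros x Hx. specialize (H5 x Hx). lra.
  - intros x Hx. specialize (H2 x Hx). lra.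
  - intros x Hx. specialize (H4 x Hx). lra.
  - intros x Hx. specialize (H6 x Hx). lra.
Qed.

Lemma bvp_solution_solves (b c f : R -> R) (eps : R) (u : R -> R) :
  0 < eps -> bvp_solution b c f eps u ->
  exists u', solves (extend b) (extend c) (extend f) eps (extend u) u'.
Proof.
  intros He [Hu [U0 [U1 Eq]]].
  destruct (Ck01_extend 2 u Hu) as [u' [Hu' Du]].
  destruct (Ck01_extend 1 u' Hu') as [u'' [_ Du']].
  exists (extend u').
  pose proof (C1_derive Du) as D1. pose proof (C1_derive Du') as D2.
  assert (Near : forall x, 0 < x < 1 -> locally x (fun t => 0 < t < 1)).
  { intros x Hx. apply (open_and (fun t => 0 < t) (fun t => t < 1)); auto.
    - apply open_gt.
    - apply open_lt. }
  assert (E1 : forall x, 0 < x < 1 -> Derive u x = extend u' x).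
  { intros x Hx. rewrite <- (is_derive_unique _ _ _ (D1 x Hx)).
    apply Derive_ext_loc. apply (filter_imp (fun t => 0 < t < 1)); auto.
    intros t Ht. symmetry. apply extend_id. lra. }
  constructor.
  - apply (C1_cont Du).
  - apply (C1_cont Du').
  - rewrite extend_id by lra. exact U0.
  - rewrite extend_id by lra. exact U1.
  - exact D1.
  - intros x Hx.
    assert (E2 : Derive_n u 2 x = extend u'' x).
    { rewrite <- (is_derive_unique _ _ _ (D2 x Hx)). simpl.
      apply Derive_ext_loc. apply (filter_imp (fun t => 0 < t < 1)); auto. }
    specialize (Eq x Hx). rewrite E1, E2 in Eq by exact Hx.
    replace (curvature (extend b) (extend c) (extend f) eps (extend u)
      (extend u') x) with (extend u'' x); [apply D2, Hx|].
    unfold curvature. rewrite !(extend_id _ x) in * by lra.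
    apply Rmult_eq_reg_l with eps; [|lra].
    replace (eps * ((c x * u x - f x - b x * u' x) / eps))
      with (c x * u x - f x - b x * u' x) by (field; lra).
    lra.
Qed.

(** * The error estimate *)

Lemma mesh_shift (a q eps : R) (N i : nat) : (1 <= N)%nat -> (1 <= i)%nat ->
  let t := INR (i - 1) / INR N in
  mesh a q eps N (i - 1) = lambda a q eps t
  /\ mesh a q eps N i = lambda a q eps (t + 1 / INR N)
  /\ mesh a q eps N (i + 1) = lambda a q eps (t + 2 / INR N).
Proof.
  intros HN Hi t. unfold mesh, t.
  assert (0 < INR N) by (apply lt_0_INR; lia).
  rewrite minus_INR, plus_INR by lia. change (INR 1) with 1.
  split; [reflexivity|split; f_equal; field; lra].
Qed.

Lemma mesh_range (a q eps : R) (N i : nat) : mesh_parameters a q eps ->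
  (1 <= N)%nat -> (i <= N)%nat -> 0 <= mesh a q eps N i <= 1.
Proof.
  intros P HN Hi. unfold mesh.
  assert (HN0 : 0 < INR N) by (apply lt_0_INR; lia).
  assert (Hi0 : 0 <= INR i) by apply pos_INR.
  assert (HiN : INR i <= INR N) by (apply le_INR, Hi).
  assert (M : forall s t, s <= t -> lambda a q eps s <= lambda a q eps t).
  { intros s t [H| ->]; [left; apply lambda_mono; auto|apply Rle_refl]. }
  split.
  - rewrite <- (lambda_at_0 a q eps P). apply M.
    apply Rmult_le_pos; [lra|left; apply Rinv_0_lt_compat, HN0].
  - rewrite <- (lambda_at_1 a q eps P). apply M.
    apply Rmult_le_reg_r with (INR N); [lra|].
    replace (INR i / INR N * INR N) with (INR i) by (field; lra). lra.
Qed.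

(** A bound for the weighted truncation error at node [i]: [C / N^2] everywhere,
    and [C / N] more when [t_{i-1}] lies within [3 / N] to the left of [q], which
    for [i] is the window from [q N - 2] to [q N + 1]. *)
Definition error_budget (C q : R) (N i : nat) : R :=
  C / INR N ^ 2 +
    (if Rlt_dec (q * INR N - 2) (INR i) then
       if Rlt_dec (INR i) (q * INR N - 2 + 3) then 1 else 0 else 0)
    * (C / INR N).

Lemma error_budget_total (C q : R) (N : nat) : 0 <= C -> (1 <= N)%nat ->
  sum_f_R0 (error_budget C q N) (N - 1) <= 5 * C / INR N.
Proof.
  intros HC HN. unfold error_budget.
  assert (HN0 : 0 < INR N) by (apply lt_0_INR; lia).
  rewrite sum_plus. rewrite sum_cte. rewrite <- scal_sum.
  replace (INR (S (N - 1))) with (INR N) by (f_equal; lia).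
  pose proof (count_in_window (q * INR N - 2) (N - 1)) as H.
  assert (0 <= C / INR N).
  { apply Rmult_le_pos; [lra|left; apply Rinv_0_lt_compat, HN0]. }
  replace (C / INR N ^ 2 * INR N) with (C / INR N) by (field; lra).
  replace (5 * C / INR N) with (C / INR N + C / INR N * 4) by (field; lra).
  apply Rplus_le_compat_l.
  apply Rmult_le_compat_l; lra.
Qed.

(** Consistency identity: the exact solution satisfies the scheme up to its
    truncation error. *)
Lemma error_upwind (b c f : R -> R) (eps : R) (N i : nat) (x U u : nat -> R)
    (v : R -> R) :
  (forall j, (j <= N)%nat -> u j = v (x j)) ->
  (1 <= i <= N - 1)%nat -> 0 < step x i -> 0 < step x (i + 1) ->
  - eps * D2 x U i - b (x i) * D1 x U i + c (x i) * U i = f (x i) ->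
  hbar x i * upwind eps (fun j => b (x j)) (fun j => c (x j)) x
    (fun j => U j - u j) i
  = weighted_truncation b c f eps v (x (i - 1)%nat) (x i) (x (i + 1)%nat).
Proof.
  intros Hu Hi S1 S2 HU.
  assert (Hh : 0 < hbar x i) by (unfold hbar; lra).
  replace (hbar x i * upwind eps (fun j => b (x j)) (fun j => c (x j)) x
    (fun j => U j - u j) i) with
    (hbar x i * (- eps * D2 x U i - b (x i) * D1 x U i + c (x i) * U i)
     - hbar x i * upwind eps (fun j => b (x j)) (fun j => c (x j)) x u i).
  2: { unfold upwind, D2, D1, Rdiv. ring. }
  rewrite HU. unfold upwind, D2, D1. rewrite !Hu by lia.
  unfold weighted_truncation.
  replace (x (i + 1)%nat - x (i - 1)%nat) with (2 * hbar x i).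
  2: { unfold hbar, step. replace (i + 1 - 1)%nat with i by lia. field. }
  replace (x (i + 1)%nat - x i) with (step x (i + 1)).
  2: { unfold step. replace (i + 1 - 1)%nat with i by lia. reflexivity. }
  change (x i - x (i - 1)%nat) with (step x i).
  field. lra.
Qed.

Lemma mesh_norm_le (N : nat) (W : nat -> R) (C : R) :
  (forall i, (i <= N)%nat -> Rabs (W i) <= C) -> mesh_norm N W <= C.
Proof.
  intros H. unfold mesh_norm.
  set (l := List.map (fun i => Rabs (W i)) (List.seq 0 (N + 1))).
  assert (Hin : In (MaxRlist l) l).
  { apply MaxRlist_P2. exists (Rabs (W 0%nat)).
    apply (in_map (fun i => Rabs (W i))), in_seq. lia. }
  apply in_map_iff in Hin. destruct Hin as [i [<- Hi]].
  apply in_seq in Hi. apply H. lia.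
Qed.

Theorem theorem4 (b c f : R -> R) (beta q a : R)
  (hb : Ck01 1 b) (hc : Ck01 1 c) (hf : Ck01 1 f)
  (hbeta : 0 < beta)
  (hbb : forall x : R, 0 <= x <= 1 -> beta <= b x)
  (hc0 : forall x : R, 0 <= x <= 1 -> 0 <= c x)
  (hq : 0 < q < 1) (ha : 4 / beta < a) :
  exists eps0 C : R, 0 < eps0 /\ 0 < C /\
    forall (eps : R) (N : nat) (u : R -> R) (U : nat -> R),
      0 < eps <= eps0 -> a * eps < q -> (2 <= N)%nat ->
      bvp_solution b c f eps u ->
      discrete_solution b c f eps N (mesh a q eps N) U ->
      mesh_norm N (fun i => U i - u (mesh a q eps N i)) <= C * / INR N.
Proof.
  assert (ha0 : 0 < a).
  { apply Rlt_trans with (4 / beta); [apply Rdiv_lt_0_compat; lra|exact ha]. }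
  destruct (coefficients_exist b c f beta hb hc hf hbeta hbb hc0)
    as [b' [c' [f' [B D]]]].
  pose proof (coeff_B D) as HB.
  destruct (solution_estimates_uniform _ _ _ _ _ _ _ _ D) as [K [HK Est]].
  destruct (mesh_step_resolves_layer a q beta hq ha0 hbeta) as [C1 [HC1 Good]].
  destruct (layer_small_near_transition a q beta hq ha0 hbeta)
    as [C2 [HC2 Bad]].
  set (T1 := (2 + B) * K). set (T2 := (2 + B + B / beta) * K).
  assert (HT1 : 0 < T1) by (apply Rmult_lt_0_compat; lra).
  assert (HT2 : 0 < T2).
  { apply Rmult_lt_0_compat; [|lra].
    assert (0 < B / beta) by (apply Rdiv_lt_0_compat; lra). lra. }
  set (C := T1 * C1 + T2 * C2).
  assert (HTC1 : 0 < T1 * C1) by (apply Rmult_lt_0_compat; lra).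
  assert (HTC2 : 0 < T2 * C2) by (apply Rmult_lt_0_compat; lra).
  assert (HC : 0 < C) by (unfold C; lra).
  exists 1, (2 / beta * (5 * C)).
  split; [lra|split].
  { apply Rmult_lt_0_compat; [apply Rdiv_lt_0_compat|]; lra. }
  intros eps N u U Heps Hsmall HN Hu [HU0 [HUN HU]].
  assert (P : mesh_parameters a q eps) by (constructor; lra).
  destruct (bvp_solution_solves b c f eps u ltac:(lra) Hu) as [u' S].
  specialize (Est eps (extend u) u' Heps S).
  destruct Hu as [_ [Hu0 [Hu1 _]]].
  assert (He0 : 0 < eps) by lra.
  set (x := mesh a q eps N) in *.
  assert (HN1 : 1 <= INR N) by (apply (le_INR 1); lia).
  assert (Hn0 : 0 < / INR N) by (apply Rinv_0_lt_compat; lra).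
  assert (Hn2 : 0 < / INR N ^ 2) by (apply Rinv_0_lt_compat, pow_lt; lra).
  assert (Xr : forall i, (i <= N)%nat -> 0 <= x i <= 1).
  { intros i Hi. apply mesh_range; auto; lia. }
  assert (X0 : x 0%nat = 0).
  { unfold x, mesh. replace (INR 0 / INR N) with 0.
    - apply lambda_at_0, P.
    - change (INR 0) with 0. field. lra. }
  assert (XN : x N = 1).
  { unfold x, mesh. replace (INR N / INR N) with 1 by (field; lra).
    apply lambda_at_1, P. }
  assert (St : forall i, (1 <= i <= N)%nat -> 0 < step x i).
  { intros i Hi. destruct (mesh_shift a q eps N i) as [M0 [M1 _]]; [lia|lia|].
    unfold step, x. rewrite M0, M1.
    apply Rlt_0_minus, lambda_mono; [exact P|]. unfold Rdiv; lra. }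
  apply mesh_norm_le. intros i Hi.
  replace (2 / beta * (5 * C) * / INR N) with (2 / beta * (5 * C / INR N))
    by (field; lra).
  eapply Rle_trans.
  - apply (upwind_stability eps beta (fun j => extend b (x j))
      (fun j => extend c (x j)) x (fun j => U j - u (x j))
      (error_budget C q N) N); try assumption; try lia; try lra.
    + intros j Hj. assert (Hx : 0 <= x j <= 1) by (apply Xr; lia).
      rewrite !extend_id by exact Hx. auto.
    + intros j. unfold error_budget.
      assert (0 <= C / INR N ^ 2) by (apply Rmult_le_pos; lra).
      assert (0 <= C / INR N) by (apply Rmult_le_pos; lra).
      destruct Rlt_dec; [destruct Rlt_dec|]; lra.
    + rewrite X0, HU0, Hu0. ring.
    + rewrite XN, HUN, Hu1. ring.
    + intros j Hj.
      rewrite (error_upwind (extend b) (extend c) (extend f) eps N j x U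
        (fun j => u (x j)) (extend u)).
      2: { intros k Hk. symmetry. apply extend_id, Xr, Hk. }
      2: exact Hj.
      2: { apply St; lia. }
      2: { apply St; lia. }
      2: { rewrite !extend_id by (apply Xr; lia). apply HU, Hj. }
      destruct (mesh_shift a q eps N j) as [M0 [M1 M2]]; [lia|lia|].
      fold x in M0, M1, M2. set (t := INR (j - 1) / INR N) in *.
      assert (Ht : t * INR N = INR j - 1).
      { unfold t. rewrite minus_INR by lia. change (INR 1) with 1. field. lra. }
      pose proof (Xr (j - 1)%nat ltac:(lia)) as R0.
      pose proof (Xr (j + 1)%nat ltac:(lia)) as R2.
      destruct (lambda_steps_increase a q eps t (INR N) P ltac:(lra))
        as [L1 [L2 L3]].
      rewrite <- M0, <- M1, <- M2 in *.
      assert (Pos1 : 0 <= C / INR N ^ 2) by (apply Rmult_le_pos; lra).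
      assert (Pos2 : 0 <= C / INR N) by (apply Rmult_le_pos; lra).
      (* Only nodes with [t] before [alpha] and within [3 / N] of [q] need the
         larger part of the budget. *)
      destruct (Rle_or_lt (alpha a q eps) t) as [Ha|Ha];
        [|destruct (Rle_or_lt (3 / INR N) (q - t)) as [Hg|Hg]].
      1, 2: apply Rle_trans with (C / INR N ^ 2);
        [|unfold error_budget; destruct Rlt_dec; [destruct Rlt_dec|]; lra];
        (eapply Rle_trans;
          [eapply truncation_smooth;
            [exact D|exact He0|exact S|exact HK|exact Est|lra ..]|]);
        rewrite M0, M1, M2, Rmult_assoc; fold T1;
        apply Rle_trans with (T1 * (C1 / INR N ^ 2));
        [apply Rmult_le_compat_l; [lra|]; apply Good; auto; lra
        |unfold C, Rdiv; rewrite <- Rmult_assoc;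
         apply Rmult_le_compat_r; lra].
      apply Rle_trans with (C / INR N).
      * eapply Rle_trans;
          [eapply truncation_rough;
            [exact D|exact He0|exact S|exact HK|exact Est|lra ..]|].
        rewrite M0, M1, M2. fold T2.
        apply Rle_trans with (T2 * (C2 / INR N)).
        -- apply Rmult_le_compat_l; [lra|]. apply Bad; auto.
        -- unfold C, Rdiv. rewrite <- Rmult_assoc.
           apply Rmult_le_compat_r; lra.
      * assert (W1 : q * INR N - 2 < INR j).
        { assert ((q - t) * INR N < 3); [|lra].
          replace 3 with (3 / INR N * INR N) by (field; lra).
          apply Rmult_lt_compat_r; lra. }
        assert (W2 : INR j < q * INR N - 2 + 3).
        { pose proof (alpha_range a q eps P).
          assert (t * INR N < q * INR N); [|lra].
          apply Rmult_lt_compat_r; lra. }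
        unfold error_budget.
        destruct Rlt_dec; [destruct Rlt_dec|]; lra.
  - apply Rmult_le_compat_l.
    + left. apply Rdiv_lt_0_compat; lra.
    + apply error_budget_total; [lra|lia].
Qed.
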